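(* For all integers $n \ge 4$ and $k \ge 4$, $$\operatorname{hc}(n,k) \ \ge\ \frac{2^{\binom{n+k-4}{n-3}}\cdot 3^{\binom{n+k-7}{k-3}}}{(n-1)k}\,\prod_{r=4}^{k}\bigl(r\,\mathrm{sf}(r-1)\bigr)^{\binom{n+k-4-r}{n-4}}\cdot\prod_{s=4}^{n}\bigl((s-1)!\bigr)^{\binom{n+k-4-s}{k-4}}.$$
   Context: Graphs are finite and without loops; parallel edges are allowed. For such a graph $G$, the cycle matroid $M_G$ has ground set $E(G)$, and its bases are the edge sets of the spanning trees of $G$. For a matroid $M$, its basis graph $\operatorname{BG}(M)$ has the bases of $M$ as vertices, two bases $B, B'$ being adjacent if and only if $|B\triangle B'|=2$. For an edge $\epsilon$ of $\operatorname{BG}(M)$, let $\operatorname{HC}_\epsilon(M)$ be the number of distinct Hamiltonian cycles of $\operatorname{BG}(M)$ containing $\epsilon$. Define $\operatorname{HC}^*(M)=\min\{\operatorname{HC}_\epsilon(M) : \epsilon \in E(\operatorname{BG}(M))\}$. Define $\operatorname{hc}(n,k)=\min\{\operatorname{HC}^*(M_G) : G \text{ a $k$-edge-connected graph of order } n\}$. The superfactorial of a nonnegative integer $x$ is $\mathrm{sf}(x)=x!\,(x-1)!\cdots 1!\,0!$. *)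

(* Defs.v *)
From mathcomp Require Import all_boot.
From mathcomp Require Import boolp.

Set Implicit Arguments.
Unset Strict Implicit.
Unset Printing Implicit Defensive.

(* Total minimum of a set of naturals; 0 on the empty set. *)
Definition nat_min (S : nat -> Prop) : nat :=
  if pselect (exists m, `[< S m >]) is left exS then ex_minn exS else 0.

(* Finite loopless multigraphs: an edge is an abstract object with exactly two
   distinct ends, so parallel edges are allowed. *)
Record mgraph := MGraph {
  vertex : finType;
  edge : finType;
  ends : edge -> {set vertex};
  card_ends : forall e, #|ends e| = 2
}.

Section Multigraph.
Variable G : mgraph.
Implicit Types (F T : {set edge G}) (u v w x y : vertex G) (e f : edge G).

Definition order_of := #|vertex G|.

Definition adj_in F : rel (vertex G) :=
  fun u v => [exists e in F, ends e == [set u; v]].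

(* Connectedness of the spanning subgraph with edge set F. *)
Definition connected_by F : bool :=
  (0 < #|vertex G|) && [forall u, forall v, connect (adj_in F) u v].

Definition connected : bool := connected_by setT.

Definition k_edge_connected (k : nat) : Prop :=
  1 < order_of /\ forall F, #|F| < k -> connected_by (~: F).

(* The list [:: (v_1, e_1); ...; (v_m, e_m)] encodes the closed walk
   v_1 e_1 v_2 e_2 ... v_m e_m v_1.  Since there are no loops, m >= 2, and
   m = 2 is a pair of parallel edges. *)
Definition walk_step : rel (vertex G * edge G) :=
  fun a b => ends a.2 == [set a.1; b.1].

Definition cycle_in F (c : seq (vertex G * edge G)) : bool :=
  [&& c != [::], uniq (unzip1 c), uniq (unzip2 c),
      all [in F] (unzip2 c) & cycle walk_step c].

Definition acyclic F : Prop := forall c, ~~ cycle_in F c.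

Definition spanning_tree T : Prop := connected_by T /\ acyclic T.

Lemma connected_byP F :
  reflect (0 < #|vertex G| /\ forall u v, connect (adj_in F) u v)
          (connected_by F).
Proof.
apply: (iffP andP) => -[h0 h]; split=> //.
  by move=> u v; move/forallP: h => /(_ u)/forallP/(_ v).
by apply/forallP=> u; apply/forallP=> v.
Qed.

Lemma adj_in_sym F : symmetric (adj_in F).
Proof. by move=> u v; apply: eq_existsb => e; rewrite (setUC [set u]). Qed.

Lemma connect_adj_in_sym F : connect_sym (adj_in F).
Proof. exact: sym_connect_sym (@adj_in_sym F). Qed.

Lemma adj_in_edge F e u v : e \in F -> ends e = [set u; v] -> adj_in F u v.
Proof. by move=> eF euv; apply/existsP; exists e; rewrite eF euv /=. Qed.

Lemma connect_adj_in_sub F T u v :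
  F \subset T -> connect (adj_in F) u v -> connect (adj_in T) u v.
Proof.
move=> FT; apply: connect_sub => x y /existsP[e /andP[eF /eqP exy]].
exact/connect1/(adj_in_edge (subsetP FT e eF)).
Qed.

Lemma endsE e : exists u v, ends e = [set u; v].
Proof.
have /eqP/cards2P[u [v [_ euv]]] := card_ends e; by exists u, v.
Qed.

Lemma walk_connect F w e c z :
  all [in F] (unzip2 ((w, e) :: c)) ->
  path walk_step (w, e) (rcons c z) -> connect (adj_in F) w z.1.
Proof.
elim: c w e => [|[w' e'] c IH] w e /= /andP[eF cF] /andP[/eqP ew pc].
  exact/connect1/(adj_in_edge eF).
apply: connect_trans (IH w' e' cF pc).
exact/connect1/(adj_in_edge eF).
Qed.

(* Deleting an edge of a cycle leaves its ends connected. *)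
Lemma cycle_in_connect F c e u v : cycle_in F c -> e \in unzip2 c ->
  ends e = [set u; v] -> connect (adj_in (F :\ e)) u v.
Proof.
case/and5P=> _ _ u2 cF cyc /mapP[[w e'] wc /= ee']; subst e'.
have [i c' Ec] := rot_to wc => euv.
have{cyc} : cycle walk_step ((w, e) :: c') by rewrite -Ec rot_cycle.
have{u2} : uniq (unzip2 ((w, e) :: c')).
  by rewrite -Ec /unzip2 map_rot rot_uniq.
have{cF} : all [in F] (unzip2 ((w, e) :: c')).
  apply/allP => f; rewrite -Ec /unzip2 map_rot mem_rot; exact: (allP cF).
move=> /= /andP[_ cF] /andP[eNc _].
have cFe : all [in F :\ e] (unzip2 c').
  apply/allP => f fc; rewrite in_setD1 (allP cF f fc) andbT.
  by apply: contraNneq eNc => <-.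
case: c' cFe {Ec cF eNc} => [|[w' e'] c'] cFe /= /andP[/eqP ew pc].
  by have := card_ends e; rewrite ew /= setUid cards1.
have /= cw := walk_connect cFe pc.
have : u \in [set w; w'] by rewrite -ew euv !inE eqxx.
have : v \in [set w; w'] by rewrite -ew euv !inE eqxx orbT.
have cw' : connect (adj_in (F :\ e)) w w' by rewrite connect_adj_in_sym.
by rewrite !inE => /orP[]/eqP-> /orP[]/eqP->.
Qed.

Lemma path_walk F u p e : path (adj_in F) u p -> uniq (u :: p) ->
  exists c, [/\ unzip1 c = belast u p, all [in F] (unzip2 c),
   uniq (unzip2 c), (forall f, f \in unzip2 c -> ends f \subset u :: p) &
   forall a, walk_step a (u, e) -> path walk_step a (rcons c (last u p, e))].
Proof.
elim: p u => [|y p IH] u.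
  by move=> _ _; exists [::]; split=> //= x ->.
rewrite [path _ _ _]/= => /andP[/existsP[f /andP[fF /eqP fuy]] pp] /andP[uN up].
have [c [c1 cF c2 cs cp]] := IH _ pp up.
exists ((u, f) :: c); split=> //=.
- by rewrite c1.
- by rewrite fF.
- rewrite c2 andbT; apply: contra uN => /cs/subsetP/(_ u).
  by apply; rewrite fuy !inE eqxx.
- move=> g; rewrite inE => /predU1P[->|/cs/subsetP gs].
    by rewrite fuy; apply/subsetP=> z; rewrite !inE => /orP[]->; rewrite ?orbT.
  by apply/subsetP=> z /gs; rewrite !inE => ->; rewrite orbT.
- move=> x xu; apply/andP; split; first exact: xu.
  by apply: cp; rewrite /walk_step /= fuy.
Qed.

Lemma acyclic_bridge F e u v : acyclic F -> e \in F -> ends e = [set u; v] ->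
  ~~ connect (adj_in (F :\ e)) u v.
Proof.
move=> Fa eF euv; apply/negP => /connectP[p0 pp0].
case/shortenP: pp0 => p pp up _ vE.
have [c [c1 cF c2 _ cp]] := path_walk e pp up.
case/negP: (Fa ((v, e) :: c)); apply/and5P; split=> //=.
- by rewrite c1 vE -rcons_uniq -lastI.
- rewrite c2 andbT; apply/negP => /(allP cF).
  by rewrite !inE eqxx.
- by rewrite eF; apply/allP=> f /(allP cF); rewrite !inE => /andP[].
- rewrite vE; apply: cp.
  by rewrite /walk_step /= -vE euv setUC.
Qed.

Definition tree_sets : {set {set edge G}} := [set T | `[< spanning_tree T >]].

Lemma tree_setsP T : reflect (spanning_tree T) (T \in tree_sets).
Proof. by rewrite inE; apply: asboolP. Qed.

Lemma tree_sets_neq0 : connected -> tree_sets != set0.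
Proof.
move=> Gc; have [T /minsetP[Tc Tmin] _] := minset_exists (P := connected_by) Gc.
apply/set0Pn; exists T; apply/tree_setsP; split=> // -[|[w e] c] //.
apply/negP => cyc; have ec : e \in unzip2 ((w, e) :: c) by rewrite /= mem_head.
have eT : e \in T by case/and5P: cyc => _ _ _ /allP/(_ _ ec).
have [u [v euv]] := endsE e.
have cuv := cycle_in_connect cyc ec euv.
have /connected_byP[V0 Tcon] := Tc.
suff /Tmin/(_ (subD1set _ _))/setP/(_ e) : connected_by (T :\ e).
  by rewrite !inE eqxx eT.
apply/connected_byP; split=> // x y.
apply: connect_sub (Tcon x y) => {}x {}y /existsP[f /andP[fT /eqP fxy]].
have [fe|fNe] := eqVneq f e; last first.
  by apply/connect1/(@adj_in_edge _ f); rewrite // !inE fNe.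
have : x \in [set u; v] by rewrite -euv -fe fxy !inE eqxx.
have : y \in [set u; v] by rewrite -euv -fe fxy !inE eqxx orbT.
by rewrite !inE => /orP[]/eqP-> /orP[]/eqP->; rewrite // connect_adj_in_sym.
Qed.

Lemma crossing (r : rel (vertex G)) (S : pred (vertex G)) u v :
  connect r u v -> S u -> ~~ S v -> exists x y, [/\ r x y, S x & ~~ S y].
Proof.
case/connectP=> p; elim: p u => [|y p IH] u /=; first by move=> _ -> ->.
move=> /andP[ruy pp] vE Su SNv.
have [Sy|SNy] := boolP (S y); first exact: IH pp vE Sy SNv.
by exists u, y.
Qed.

Lemma tree_sets_exchange A B a : A \in tree_sets -> B \in tree_sets ->
  a \in A :\: B ->
  exists2 b, b \in B :\: A & b |: (A :\ a) \in tree_sets.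
Proof.
move=> /tree_setsP[/connected_byP[V0 Acon] Aacy].
move=> /tree_setsP[/connected_byP[_ Bcon] _] /setDP[aA aB].
have [u [v auv]] := endsE a.
have br := acyclic_bridge Aacy aA auv.
have [x [y [/existsP[b /andP[bB /eqP bxy]] Sx Sy]]] :=
  crossing (S := connect (adj_in (A :\ a)) u) (Bcon u v) (connect0 _ _) br.
have ba : b != a by apply: contraNneq aB => <-.
have nxy : ~~ connect (adj_in (A :\ a)) x y.
  by apply: contra Sy; apply: connect_trans.
have bA : b \notin A.
  apply: contra nxy => bA; apply/connect1/(@adj_in_edge _ b) => //.
  by rewrite !inE ba.
have subA : A :\ a \subset b |: (A :\ a) by apply: subsetUr.
exists b; first by rewrite !inE bA.
apply/tree_setsP; split.
  have cu z : connect (adj_in (A :\ a)) u z || connect (adj_in (A :\ a)) v z.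
    apply/negPn/negP => nz.
    have uu : connect (adj_in (A :\ a)) u u || connect (adj_in (A :\ a)) v u.
      by rewrite connect0.
    have [s [t [/existsP[f /andP[fA /eqP fst]] Ss St]]] :=
      crossing (S := fun z => connect (adj_in (A :\ a)) u z
                           || connect (adj_in (A :\ a)) v z)
        (Acon u z) uu nz.
    have [fa|fNa] := eqVneq f a.
      have : t \in [set u; v] by rewrite -auv -fa fst !inE eqxx orbT.
      rewrite !inE => /orP[]/eqP tE; move: St;
      by rewrite tE connect0 ?orbT.
    have cst : connect (adj_in (A :\ a)) s t.
      by apply/connect1/(@adj_in_edge _ f); rewrite // !inE fNa.
    case/negP: St; case/orP: Ss => /connect_trans/(_ cst) ->; by rewrite ?orbT.
  have cuv : connect (adj_in (b |: (A :\ a))) u v.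
    apply: connect_trans (connect_adj_in_sub subA Sx) _.
    apply: (@connect_trans _ _ y).
      by apply/connect1/(@adj_in_edge _ b); rewrite // !inE eqxx.
    rewrite connect_adj_in_sym; apply: (connect_adj_in_sub subA).
    by have := cu y; rewrite (negPf Sy).
  have cuz z : connect (adj_in (b |: (A :\ a))) u z.
    have /orP[] := cu z; move/(connect_adj_in_sub subA) => // vz.
    exact: connect_trans cuv vz.
  apply/connected_byP; split=> // s t; apply: connect_trans (cuz t).
  by rewrite connect_adj_in_sym.
move=> c; apply/negP => cyc.
have bAa : b \notin A :\ a by rewrite !inE (negPf bA) andbF.
have [bc|bc] := boolP (b \in unzip2 c).
  have := cycle_in_connect cyc bc bxy.
  by rewrite setU1K // (negPf nxy).
case/negP: (Aacy c); case/and5P: cyc => c0 c1 c2 cF cc; apply/and5P; split=> //.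
apply/allP => f fc; have := allP cF f fc.
by rewrite !inE; case: eqP fc bc => [-> ->|_ _ _ /andP[]].
Qed.

End Multigraph.

Record matroid (E : finType) := Matroid {
  bases : {set {set E}};
  bases_neq0 : bases != set0;
  bases_exchange : forall A B a, A \in bases -> B \in bases -> a \in A :\: B ->
    exists2 b, b \in B :\: A & b |: (A :\ a) \in bases
}.

Definition cycle_matroid (G : mgraph) (Gc : connected G) : matroid (edge G) :=
  Matroid (tree_sets_neq0 Gc) (@tree_sets_exchange G).

Section SimpleGraph.
Variables (V : finType) (r : rel V).

Definition graph_edges : {set {set V}} :=
  [set [set x; y] | x in V, y in V & r x y].

Definition hamiltonian (c : seq V) : bool :=
  [&& 2 < size c, uniq c, [forall x, x \in c] & cycle r c].

Definition cycle_edges (c : seq V) : {set {set V}} :=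
  [set [set x; next c x] | x in c].

(* A Hamiltonian cycle is identified with its edge set, so that rotations and
   reversals of a vertex sequence are not counted separately. *)
Definition hamilton_cycles : {set {set {set V}}} :=
  [set cycle_edges c | c : #|V|.-tuple V & hamiltonian c].

End SimpleGraph.

Section BasisGraph.
Variables (E : finType) (M : matroid E).

Definition basis := {B : {set E} | B \in bases M}.

Definition basis_adj : rel basis :=
  fun B B' => #|(val B :\: val B') :|: (val B' :\: val B)| == 2.

Definition HC (eps : {set basis}) : nat :=
  #|[set C in hamilton_cycles basis_adj | eps \in C]|.

Definition HC_star : nat :=
  nat_min (fun m => exists2 eps, eps \in graph_edges basis_adj & m = HC eps).

End BasisGraph.

(* For k >= 1 the connectedness Gc, which is needed to form the cycle matroid,
   follows from k-edge-connectedness. *)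
Definition hc (n k : nat) : nat :=
  nat_min (fun m => exists (G : mgraph) (Gc : connected G),
    [/\ order_of G = n, k_edge_connected G k & m = HC_star (cycle_matroid Gc)]).

Definition superfactorial (x : nat) : nat := \prod_(i < x.+1) i`!.

(* Main.v *)
Require Import Defs.
From mathcomp Require Import all_boot all_order all_algebra.
From mathcomp Require Import boolp zify ring.

(** Split the bases of a matroid according to an element [a]: those containing
    [a] are the bases of [M / a], the others those of [M \ a].  If [X] and [Y]
    are adjacent bases with [X :\: Y = [set a]], then a Hamiltonian path of
    [M / a] from [X] to a neighbour [A] and one of [M \ a] from a neighbour [D]
    of [Y] to [Y] can be spliced into a Hamiltonian path from [X] to [Y] whenever
    [A] and [D] are adjacent, and closing it with the edge [XY] gives a
    Hamiltonian cycle.  In rank [r] and cogirth at least [k >= 3] the rank 2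
    minors of [M] supply at least [(r - 1)(k - 1)] such pairs [(A, D)], so the
    minimal number [h] of paths satisfies
    [h r k >= (r - 1) (k - 1) (h (r - 1) k) (h r (k - 1))].  The recursion starts
    from the uniform matroids of rank 1, where [h 1 k >= (k - 2)!], and from
    [h r 2 >= 2 ^ (r - 2)]; its solution is the stated product.  The cycle
    matroid of a [k]-edge-connected graph of order [n] has rank [n - 1] and
    cogirth at least [k]. *)

Set Implicit Arguments.
Unset Strict Implicit.
Unset Printing Implicit Defensive.

(** * Hamiltonian paths in basis graphs *)

Section HamiltonianPaths.
Variable E : finType.
Implicit Types (A B C D S W X Y Z : {set E}) (a b c d x y z : E).
Implicit Types (BB : {set {set E}}) (p q s : seq {set E}).

(** The axiom is put on bare set families, so that minors are simply subfamilies over the same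
    ground set. *)
Definition exchange BB := forall A B a, A \in BB -> B \in BB -> a \in A :\: B ->
  exists2 b, b \in B :\: A & b |: (A :\ a) \in BB.

Definition set_adj : rel {set E} := fun A B => #|(A :\: B) :|: (B :\: A)| == 2.

Lemma set_adj_sym : symmetric set_adj.
Proof. by move=> A B; rewrite /set_adj setUC. Qed.

Lemma set_adj_neq A B : set_adj A B -> A != B.
Proof. by apply: contraTneq => ->; rewrite /set_adj setDv setU0 cards0. Qed.

Lemma set_adj_swap S x y : x \notin S -> y \notin S -> x != y ->
  set_adj (x |: S) (y |: S).
Proof.
move=> xS yS xy; rewrite /set_adj.
suff -> : (x |: S) :\: (y |: S) :|: (y |: S) :\: (x |: S) = [set x; y].
  by rewrite cards2 xy.
apply/setP => z; rewrite !inE.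
have [->|zx] := eqVneq z x; first by rewrite (negPf xy) (negPf xS).
have [->|zy] := eqVneq z y; first by rewrite (negPf yS).
by case: (z \in S).
Qed.

Lemma setU1_inj S x y : x \notin S -> x |: S = y |: S -> x = y.
Proof.
move=> xS /setP/(_ x); rewrite !inE eqxx (negPf xS) /= orbF.
by move/esym/eqP.
Qed.

(** Repeated exchanges move [A'] towards [B'] at constant cardinality until it is contained in
    [B']. *)
Lemma exchange_card BB A B : exchange BB -> A \in BB -> B \in BB ->
  #|A| = #|B|.
Proof.
move=> ex; suff le A' B' : A' \in BB -> B' \in BB -> #|A'| <= #|B'|.
  by move=> AB BB'; apply/eqP; rewrite eqn_leq !le.
have [m] := ubnP #|A' :\: B'|; elim: m A' => // m IH A' lem AB BB'.
have [/eqP|[a aAB]] := set_0Vmem (A' :\: B').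
  by rewrite setD_eq0; apply: subset_leq_card.
have [b] := ex _ _ _ AB BB' aAB; rewrite inE => /andP[bA bB] bAB.
move: (aAB); rewrite inE => /andP[aB aA].
have bAa : b \notin A' :\ a by rewrite inE (negPf bA) andbF.
have cE : #|b |: (A' :\ a)| = #|A'| by rewrite cardsU1 bAa (cardsD1 a A') aA.
rewrite -cE; apply: IH => //; apply: leq_trans (_ : #|A' :\: B'| <= m) => //.
apply: proper_card; apply/properP; split.
  apply/subsetP => z; rewrite !inE => /andP[zB /predU1P[zb|/andP[]]] //.
    by rewrite zb bB in zB.
  by rewrite zB.
by exists a => //; rewrite !inE aB eqxx /= orbF; apply: contraNneq aB => ->.
Qed.

Lemma set_adjP A B : #|A| = #|B| -> set_adj A B ->
  exists S x y, [/\ A = x |: S, B = y |: S, x \notin S, y \notin S & x != y].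
Proof.
move=> AB /eqP; rewrite cardsU.
have -> : (A :\: B) :&: (B :\: A) = set0.
  by apply/setP => z; rewrite !inE; case: (z \in A); rewrite ?andbF.
rewrite cards0 subn0 => c2.
have cAB : #|A :\: B| = #|B :\: A| by rewrite !cardsD AB setIC.
have /eqP/cards1P[x xE] : #|A :\: B| = 1 by lia.
have /eqP/cards1P[y yE] : #|B :\: A| = 1 by lia.
exists (A :&: B), x, y.
have := setID A B; have := setID B A; rewrite xE yE (setIC B A) => BE AE.
have : x \in A :\: B by rewrite xE set11.
have : y \in B :\: A by rewrite yE set11.
rewrite !inE => /andP[yA yB] /andP[xB xA].
rewrite (negPf xB) (negPf yA) andbF; split=> //; try by rewrite setUC.
by apply: contraNneq xB => ->.
Qed.

(** A path is stored without its first vertex [X], as an ordering of [BB :\ X]. For [BB = [set X]]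
    and [Y = X] the only path is the empty list. *)
Definition hpaths BB X Y : seq (seq {set E}) :=
  [seq p <- permutations (enum (BB :\ X)) | path set_adj X p && (last X p == Y)].

Lemma hpaths_uniq BB X Y : uniq (hpaths BB X Y).
Proof. by rewrite filter_uniq // permutations_uniq. Qed.

Lemma hpathsP BB X Y p : X \in BB ->
  reflect [/\ uniq (X :: p), X :: p =i BB, path set_adj X p & last X p = Y]
          (p \in hpaths BB X Y).
Proof.
move=> XB; rewrite mem_filter mem_permutations.
apply: (iffP andP) => [[/andP[pp /eqP lp] pe]|[up pm pp lp]].
  have Xp : X \notin p by rewrite (perm_mem pe) mem_enum !inE eqxx.
  split=> //=; first by rewrite Xp (perm_uniq pe) enum_uniq.
  move=> Z; rewrite inE (perm_mem pe) mem_enum !inE.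
  by have [->|] := eqVneq Z X.
rewrite pp lp eqxx; split=> //; move: up => /= /andP[Xp up].
apply: uniq_perm => //; first exact: enum_uniq.
move=> Z; rewrite mem_enum !inE -pm inE.
by have [->|//] := eqVneq Z X; rewrite (negPf Xp).
Qed.

Lemma hpaths1 X : size (hpaths [set X] X X) = 1.
Proof.
by rewrite /hpaths setDv enum_set0 /= eqxx.
Qed.

Lemma hpaths_rev BB X Y : X \in BB -> Y \in BB ->
  size (hpaths BB Y X) <= size (hpaths BB X Y).
Proof.
move=> XB YB.
pose f p := behead (rev (Y :: p)).
have fE p : p \in hpaths BB Y X -> X :: f p = rev (Y :: p).
  case/(hpathsP _ _ YB) => _ _ _ <-; by rewrite /f (lastI Y p) rev_rcons.
rewrite -(size_map f); apply: uniq_leq_size.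
  rewrite map_inj_in_uniq ?hpaths_uniq // => p q pH qH fpq.
  have : rev (Y :: p) = rev (Y :: q) by rewrite -!fE // fpq.
  by move/(congr1 rev); rewrite !revK => -[].
move=> _ /mapP[p pH ->]; apply/(hpathsP _ _ XB).
have := fE p pH; case/(hpathsP _ _ YB): pH => up pm pp lp E0.
split; first by rewrite E0 rev_uniq.
- by move=> Z; rewrite E0 mem_rev.
- have : path set_adj (last Y p) (behead (rev (Y :: p))).
    have -> : behead (rev (Y :: p)) = rev (belast Y p).
      by rewrite (lastI Y p) rev_rcons.
    rewrite rev_path; apply: sub_path pp => A B; by rewrite /= set_adj_sym.
  by rewrite lp.
by have := congr1 (last X) E0; rewrite rev_cons last_rcons.
Qed.

End HamiltonianPaths.

(** * Splicing paths *)

Section Splices.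
Variable E : finType.
Implicit Types (A B D W X Y Z : {set E}) (a b : E).
Implicit Types (BB : {set {set E}}) (p q s : seq {set E}).
Implicit Types (P : seq ({set E} * {set E})) (Q : pred {set E}).

(** When [Q] is membership of [a] this is the contraction by [a], except that [a] stays in every
    basis; when [Q] is non-membership it is the deletion. *)
Definition part BB Q := [set B in BB | Q B].

Lemma mem_part BB Q A : (A \in part BB Q) = (A \in BB) && Q A.
Proof. by rewrite inE. Qed.

(** [x.2] is inserted between the halves because a stored path omits its first vertex. *)
Definition splices BB Q X Y P : seq (seq {set E}) :=
  [seq y.1 ++ x.2 :: y.2 | x <- P,
     y <- [seq (p, q) | p <- hpaths (part BB Q) X x.1,
                        q <- hpaths (part BB (fun B => ~~ Q B)) x.2 Y]].

Definition link BB Q (x : {set E} * {set E}) :=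
  [&& x.1 \in BB, Q x.1, x.2 \in BB, ~~ Q x.2 & set_adj x.1 x.2].

Section Fixed.
Variables (BB : {set {set E}}) (Q : pred {set E}) (X Y : {set E}).
Variable P : seq ({set E} * {set E}).
Hypotheses (XB : X \in BB) (QX : Q X).
Hypothesis lP : all (link BB Q) P.

Let XQ : X \in part BB Q. Proof. by rewrite inE XB. Qed.

Lemma splicesP s : s \in splices BB Q X Y P ->
  exists x p q, [/\ x \in P, link BB Q x, s = p ++ x.2 :: q,
    p \in hpaths (part BB Q) X x.1 & q \in hpaths (part BB (fun B => ~~ Q B)) x.2 Y].
Proof.
case/allpairsPdep => x [y [xP /allpairsP[[p q] /= [pH qH ->]] ->]].
by exists x, p, q; split=> //; apply: (allP lP).
Qed.

Lemma link_right x : link BB Q x -> x.2 \in part BB (fun B => ~~ Q B).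
Proof. by case/and5P=> _ _ x2 nQ _; rewrite inE x2. Qed.

Lemma splices_sub : {subset splices BB Q X Y P <= hpaths BB X Y}.
Proof.
move=> s /splicesP[[A D] [p [q [_ lx -> pH qH]]]].
have DQ := link_right lx; case/and5P: lx => /= AB QA DB QD AD.
case/(hpathsP _ _ XQ): pH => up pm pp lp.
case/(hpathsP _ _ DQ): qH => uq qm pq lq.
apply/(hpathsP _ _ XB); split.
- rewrite -cat_cons cat_uniq up uq andbT; apply/hasPn => Z.
  by rewrite /= qm !inE => /andP[ZB]; apply: contra; rewrite -in_cons pm inE ZB.
- move=> Z; rewrite -cat_cons mem_cat pm qm !inE /=.
  by case: (Z \in BB); case: (Q Z).
- by rewrite cat_path pp lp /= AD pq.
- by rewrite last_cat.
Qed.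

(** A splice can be decoded: filtering by [Q] and by its negation returns the two halves, the second
    with [D] in front, and [A] is the last vertex of the first. *)
Lemma splices_uniq : uniq P -> uniq (splices BB Q X Y P).
Proof.
move=> uP; apply: allpairs_uniq_dep => // [x xP|].
  apply: allpairs_uniq; rewrite ?hpaths_uniq //.
  by move=> [p q] [p' q'] _ _ [-> ->].
have aux u : u \in [seq existT (fun=> seq {set E} * seq {set E})%type x y
     | x <- P, y <- [seq (p, q) | p <- hpaths (part BB Q) X x.1,
                        q <- hpaths (part BB (fun B => ~~ Q B)) x.2 Y]] ->
  [/\ filter Q ((tagged u).1 ++ (tag u).2 :: (tagged u).2) = (tagged u).1,
      filter (fun B => ~~ Q B) ((tagged u).1 ++ (tag u).2 :: (tagged u).2)
        = (tag u).2 :: (tagged u).2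
    & last X (tagged u).1 = (tag u).1].
  case/allpairsPdep => x [y [xP /allpairsP[z [pH qH yE]] uE]].
  have -> : tag u = x by rewrite uE.
  have -> : tagged u = z by rewrite uE yE; case: (z).
  case: x z xP pH qH {yE uE} => A D [p q] /= xP pH qH.
  have DQ := link_right (allP lP _ xP).
  case/(hpathsP _ _ XQ): pH => _ pm _ lp.
  case/(hpathsP _ _ DQ): qH => _ qm _ _.
  have pQ Z : Z \in p -> Q Z.
    move=> Zp; have : Z \in X :: p by rewrite inE Zp orbT.
    by rewrite pm inE => /andP[].
  have qQ Z : Z \in D :: q -> ~~ Q Z by rewrite qm inE => /andP[].
  have eq1 : filter Q p = p by apply/all_filterP/allP.
  have eq2 : filter (fun B => ~~ Q B) (D :: q) = D :: q.
    by apply/all_filterP/allP.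
  have eq3 : filter Q (D :: q) = [::].
    by apply/eqP; rewrite -[_ == _]negbK -has_filter; apply/hasPn.
  have eq4 : filter (fun B => ~~ Q B) p = [::].
    apply/eqP; rewrite -[_ == _]negbK -has_filter; apply/hasPn => Z.
    by move/pQ => /= ->.
  split; [|exact: etrans (filter_cat _ _ _) (f_equal2 cat eq4 eq2)|exact: lp].
  by apply: etrans (filter_cat _ _ _) _; rewrite eq1 [X in _ ++ X]eq3 cats0.
move=> [[A D] [p q]] [[A' D'] [p' q']] /aux/= [f1 f2 l] /aux/= [f1' f2' l'] e.
by move: f1' f2'; rewrite -e f1 f2 => pp' [-> ->]; rewrite -l -l' pp'.
Qed.

Lemma size_splices m1 m2 :
  (forall x, x \in P -> m1 <= size (hpaths (part BB Q) X x.1)) ->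
  (forall x, x \in P -> m2 <= size (hpaths (part BB (fun B => ~~ Q B)) x.2 Y)) ->
  size P * (m1 * m2) <= size (splices BB Q X Y P).
Proof.
rewrite /splices size_allpairs_dep; elim: P => //= x P' IH h1 h2.
rewrite mulSn leq_add ?size_allpairs ?leq_mul ?h1 ?h2 ?mem_head //.
by apply: IH => z zP; rewrite ?h1 ?h2 // inE zP orbT.
Qed.

Lemma splice_bound m1 m2 : uniq P ->
  (forall x, x \in P -> m1 <= size (hpaths (part BB Q) X x.1)) ->
  (forall x, x \in P -> m2 <= size (hpaths (part BB (fun B => ~~ Q B)) x.2 Y)) ->
  size P * (m1 * m2) <= size (hpaths BB X Y).
Proof.
move=> uP h1 h2; apply: leq_trans (size_splices h1 h2) _.
exact/uniq_leq_size/splices_sub/splices_uniq.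
Qed.

End Fixed.

(* Along a path of the first family the bases containing [a] come first, along
   one of the second those containing [b] come last; a basis [W] containing both
   must then lie beyond the last basis containing [a]. *)
Lemma splices_disjoint BB X Y P P' a b W :
  X \in BB -> a \in X -> b \notin X ->
  all (link BB (fun B => a \in B)) P ->
  all (link BB (fun B => b \notin B)) P' ->
  (forall x, x \in P -> b \notin x.1) ->
  W \in BB -> a \in W -> b \in W ->
  ~~ has [in splices BB (fun B => a \in B) X Y P]
     (splices BB (fun B => b \notin B) X Y P').
Proof.
move=> XB aX bX lP lP' bP WB aW bW; apply/hasPn => s.
case/(splicesP lP') => -[A' D'] [p' [q' [_ lx' /= -> pH' qH']]].
apply/negP => /(splicesP lP)[[A D] [p [q [/bP /= bA lx eq_s pH qH]]]].
have XQ : X \in part BB (fun B => a \in B) by rewrite inE XB.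
have XQ' : X \in part BB (fun B => b \notin B) by rewrite inE XB.
case/(hpathsP _ _ XQ): pH => _ pm _ lp.
case/(hpathsP _ _ (link_right lx')): qH' => _ qm' _ _.
case/(hpathsP _ _ XQ'): pH' => _ pm' _ lp'.
(* [W] belongs to the initial stretch of bases containing [a], and it is not the last of them, [A],
   which omits [b]. *)
have Wp : W \in belast X p.
  have : W \in X :: p by rewrite pm inE WB.
  by rewrite lastI mem_rcons inE lp => /predU1P[WA|//]; rewrite -WA bW in bA.
(* As a splice of the second family the path never loses [b] once it has it; but [W] contains [b]
   and the later [A] does not. *)
have pw : pairwise (fun B B' : {set E} => (b \in B) ==> (b \in B'))
            (X :: p' ++ D' :: q').
  rewrite -cat_cons pairwise_cat; apply/and3P; split.
  - apply/allrelP => B B'; rewrite pm' !inE => /andP[_ bB] _.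
    by rewrite (negPf bB).
  - apply/(pairwiseP set0) => i j iX jX _.
    by have := mem_nth set0 iX; rewrite pm' inE => /andP[_ /negPf->].
  - apply/(pairwiseP set0) => i j iX jX _.
    have := mem_nth set0 jX; rewrite qm' inE /= negbK => /andP[_ ->].
    by rewrite implybT.
move: pw; rewrite eq_s -cat_cons lastI lp cat_rcons pairwise_cat.
case/and3P => /allrelP/(_ W A Wp (mem_head _ _)) + _ _.
by rewrite bW (negPf bA).
Qed.

End Splices.

(** * Linking pairs for an edge of the basis graph *)

Section Exchange.
Variable E : finType.
Implicit Types (A B C D S W X Y Z : {set E}) (a b c d x y z : E).
Implicit Types (BB : {set {set E}}).

Lemma exchange_part_in BB a : exchange BB ->
  exchange (part BB (fun B => a \in B)).
Proof.
move=> ex A B e; rewrite ![_ \in part _ _]inE => /andP[AB aA] /andP[BB' aB] eAB.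
have [f fBA fA] := ex _ _ _ AB BB' eAB; exists f => //.
move: eAB; rewrite !inE fA aA => /andP[eB _] /=.
by rewrite andbT [a == e]eq_sym (contraNneq _ eB) ?orbT // => ->.
Qed.

Lemma exchange_part_notin BB a : exchange BB ->
  exchange (part BB (fun B => a \notin B)).
Proof.
move=> ex A B e; rewrite ![_ \in part _ _]inE => /andP[AB aA] /andP[BB' aB] eAB.
have [f fBA fA] := ex _ _ _ AB BB' eAB; exists f => //.
rewrite !inE fA (negPf aA) andbF orbF /=.
by apply: contraNneq aB => ->; move: fBA; rewrite inE => /andP[].
Qed.

Definition extensions BB S := [set x | x |: S \in BB].

Lemma mem_extensions BB S x : (x \in extensions BB S) = (x |: S \in BB).
Proof. by rewrite inE. Qed.

Lemma card_setD1_geq m S x : m < #|S| -> m <= #|S :\ x|.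
Proof. by rewrite (cardsD1 x); case: (x \in S) => // /ltnW. Qed.

Section Pairs.
Variables (BB : {set {set E}}) (D : {set E}) (a b c : E).
Hypotheses (ex : exchange BB) (cD : c \notin D).
Hypotheses (aC : a \notin c |: D) (bC : b \notin c |: D) (ab : a != b).
Local Notation t x y := (x |: (y |: D)).
Local Notation ind x y := (t x y \in BB).
Hypotheses (XB : ind a c) (YB : ind b c).

Let aD : a \notin D. Proof. by move: aC; rewrite !inE negb_or => /andP[]. Qed.
Let bD : b \notin D. Proof. by move: bC; rewrite !inE negb_or => /andP[]. Qed.
Let ac : a != c. Proof. by move: aC; rewrite !inE negb_or => /andP[]. Qed.
Let bc : b != c. Proof. by move: bC; rewrite !inE negb_or => /andP[]. Qed.

Let tC x y : t x y = t y x. Proof. exact: setUCA. Qed.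
Let indC x y : ind x y = ind y x. Proof. by rewrite tC. Qed.

Let mem_t z x y : (z \in t x y) = [|| z == x, z == y | z \in D].
Proof. by rewrite !inE. Qed.

Let ind_neq x y : ind x y -> [/\ x != y, x \notin D & y \notin D].
Proof.
move=> /(exchange_card ex XB); rewrite !cardsU1 aC cD !addnA => /addIn.
rewrite !inE; case: (eqVneq x y) => [->|_]; first by case: (y \in D).
by case: (x \in D); case: (y \in D).
Qed.

(* In the rank 2 minor on which [ind] is the relation of being a basis,
   not being parallel to [z] is a property of at least one of any two
   independent elements. *)
Lemma nonparallel_trans x y z w : ind x y -> ind z w -> ind z x || ind z y.
Proof.
move=> xy zw; have [zw' zD wD] := ind_neq zw.
have [->|wx] := eqVneq x w; first by rewrite zw.
have [->|wy] := eqVneq y w; first by rewrite zw orbT.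
have [e] : exists2 e, e \in t x y :\: t z w & e |: (t z w :\ w) \in BB.
  apply: ex => //; rewrite in_setD !mem_t eqxx orbT andbT /=.
  by rewrite !(eq_sym w) (negPf wx) (negPf wy).
rewrite in_setD !mem_t => /andP[/norP[_ /norP[_ eD]]].
rewrite (negPf eD) orbF => exy; rewrite tC setU1K; last first.
  by rewrite !inE negb_or eq_sym zw'.
by rewrite indC; case/orP: exy => /eqP->  ->; rewrite ?orbT.
Qed.

Let adj_t x y z : x \notin D -> y \notin D -> z \notin D ->
  x != y -> x != z -> y != z -> set_adj (t x z) (t y z).
Proof.
move=> xD yD zD xy xz yz.
by apply: set_adj_swap; rewrite // !inE negb_or ?xz ?yz.
Qed.

Let t_inj x y z : ind z x -> t z x = t z y -> x = y.
Proof.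
move=> /ind_neq[zx zD xD] /setP/(_ x); rewrite !mem_t eqxx orbT.
by rewrite eq_sym (negPf zx) (negPf xD) orbF => /esym/eqP.
Qed.

(** The edge joins [X = t a c] and [Y = t b c]. Because of [c \notin x.1] the step from [X] to [x.1]
    removes [c], so that pairs found for different [c] are different. *)
Definition good_pair (x : {set E} * {set E}) :=
  [&& link BB (fun B => a \in B) x, set_adj (t a c) x.1, set_adj x.2 (t b c)
    & c \notin x.1].

(** When [a] and [b] are parallel in the rank 2 minor they are independent of the same elements, so
    [b] may replace [a]. *)
Lemma good_pair_parallel x : ~~ ind a b -> ind a x -> x != c ->
  good_pair (t a x, t b x).
Proof.
move=> nab ax xc; have [nax _ xD] := ind_neq ax.
have nbx : b != x by apply: contraNneq nab => ->.
have bx : ind b x by have := nonparallel_trans ax YB; rewrite indC (negPf nab).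
apply/and4P; split; [apply/and5P; split=> //= | | |] => /=.
- by rewrite mem_t eqxx.
- by rewrite mem_t !negb_or ab nax aD.
- by apply: adj_t.
- by rewrite ![t a _]tC; apply: adj_t; rewrite // eq_sym.
- by rewrite ![t b _]tC; apply: adj_t; rewrite // eq_sym.
- by rewrite mem_t !negb_or ![c == _]eq_sym ac xc cD.
Qed.

(** Since [b] and [c] are independent, [x] is not parallel to both; one to which it is not parallel
    completes the second basis, and either choice is adjacent to [t b c]. *)
Lemma good_pair_link x : ind a b -> ind a x -> x != c -> x != b ->
  good_pair (t a x, if ind b x then t b x else t c x).
Proof.
move=> nab ax xc xb; have [nax _ xD] := ind_neq ax.
have xa : ind x a by rewrite indC.
have := nonparallel_trans YB xa; rewrite indC => bxc.
set y := if ind b x then b else c.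
have -> : (if ind b x then t b x else t c x) = t y x by rewrite /y; case: ifP.
have yx : ind y x.
  by rewrite /y; case: ifP bxc => //= _; rewrite indC.
have [ya yD] : a != y /\ y \notin D by rewrite /y; case: ifP.
have [nyx _ _] := ind_neq yx.
apply/and4P; split; [apply/and5P; split=> //= | | |] => /=.
- by rewrite mem_t eqxx.
- by rewrite mem_t !negb_or ya nax aD.
- by apply: adj_t.
- by rewrite ![t a _]tC; apply: adj_t; rewrite // eq_sym.
- rewrite /y; case: ifP => _; first rewrite ![t b _]tC; last rewrite [t c x]tC.
    by apply: adj_t; rewrite // eq_sym.
  by apply: adj_t; rewrite // eq_sym.
- by rewrite mem_t !negb_or ![c == _]eq_sym ac xc cD.
Qed.

Lemma good_pair_both x : ind a b -> ind b x -> x != c -> x != a ->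
  good_pair (t a b, t b x).
Proof.
move=> nab bx xc xa; have [nbx _ xD] := ind_neq bx.
apply/and4P; split; [apply/and5P; split=> //= | | |] => /=.
- by rewrite mem_t eqxx.
- by rewrite mem_t !negb_or ab [a == x]eq_sym xa aD.
- by rewrite [t b x]tC; apply: adj_t; rewrite // eq_sym.
- by rewrite ![t a _]tC; apply: adj_t; rewrite // eq_sym.
- by rewrite ![t b _]tC; apply: adj_t; rewrite // eq_sym.
- by rewrite mem_t !negb_or ![c == _]eq_sym ac bc cD.
Qed.

(** If [a] and [b] are parallel, every [x] other than [c] that is independent of [a] gives a pair.
    Otherwise [b] has to be left out as well, and the pairs starting from [t a b] make up for it. *)
Lemma card_good_pairs k : k.+3 <= #|extensions BB (a |: D)| ->
  k.+3 <= #|extensions BB (b |: D)| ->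
  k.+2 <= #|[set x | good_pair x]|.
Proof.
have memS x y : (y \in extensions BB (x |: D)) = ind x y.
  by rewrite inE indC.
move=> cSa cSb.
have [iab|nab] := boolP (ind a b); last first.
  pose f x := (t a x, t b x).
  have inj : {in extensions BB (a |: D) :\ c &, injective f}.
    move=> x y; rewrite in_setD1 memS => /andP[_ ax] _ [+ _].
    exact: t_inj.
  apply: leq_trans (_ : #|f @: (extensions BB (a |: D) :\ c)| <= _).
    by rewrite card_in_imset // card_setD1_geq.
  apply/subset_leq_card/subsetP => _ /imsetP[x + ->].
  by rewrite in_setD1 memS inE => /andP[xc ax]; apply: good_pair_parallel.
pose f x := (t a x, if ind b x then t b x else t c x).
pose g x := (t a b, t b x).
set F := extensions BB (a |: D) :\ c :\ b.
set H := extensions BB (b |: D) :\ c :\ a.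
have injf : {in F &, injective f}.
  move=> x y; rewrite !in_setD1 memS => /and3P[_ _ ax] _ [+ _].
  exact: t_inj.
have injg : {in H &, injective g}.
  move=> x y; rewrite !in_setD1 memS => /and3P[_ _ ax] _ [+].
  exact: t_inj.
have cF : k.+1 <= #|F|.
  by rewrite !card_setD1_geq.
have cH : k.+1 <= #|H|.
  by rewrite !card_setD1_geq.
have disj : (f @: F) :&: (g @: H) = set0.
  (* The first components tell the two kinds apart: [t a b] occurs only in the second. *)
  apply/setP => z; rewrite !inE; apply/negP => /andP[/imsetP[x + ->]].
  rewrite !in_setD1 memS => /and3P[xb _ ax] /imsetP[y _ [+ _]].
  by move/(t_inj ax) => xb'; rewrite xb' eqxx in xb.
have cU : #|f @: F :|: g @: H| = #|F| + #|H|.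
  by rewrite cardsU disj cards0 subn0 !card_in_imset.
apply: leq_trans (_ : #|f @: F :|: g @: H| <= _); first rewrite cU.
  by apply: leq_trans (leq_add cF cH); rewrite addSn addnS !ltnS leq_addr.
apply/subset_leq_card/subsetP => _ /setUP[] /imsetP[x + ->].
  by rewrite !in_setD1 memS inE => /and3P[xb xc ax]; apply: good_pair_link.
by rewrite !in_setD1 memS inE => /and3P[xb xc ax]; apply: good_pair_both.
Qed.

End Pairs.
End Exchange.

(** * Existence of Hamiltonian paths between adjacent bases *)

Section Splitting.
Variable E : finType.
Implicit Types (A B C D S W X Y Z : {set E}) (a b c d x y z : E).
Implicit Types (BB : {set {set E}}).

(** The degenerate case is a part with a single basis, where the trivial path is Hamiltonian. *)
Definition joinable BB X Y := if X == Y then BB == [set X] else set_adj X Y.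

Lemma adj_joinable BB X Y : set_adj X Y -> joinable BB X Y.
Proof. by move=> XY; rewrite /joinable (negPf (set_adj_neq XY)). Qed.

Lemma exchange_subD BB A B : exchange BB -> A \in BB -> B \in BB -> A != B ->
  exists x, x \in A :\: B.
Proof.
move=> ex AB BB' nAB; apply/set0Pn; apply: contra nAB; rewrite setD_eq0 => sAB.
by rewrite eqEcard sAB (exchange_card ex AB BB') leqnn.
Qed.

Section Edge.
Variables (BB : {set {set E}}) (C : {set E}) (a b : E).
Hypotheses (ex : exchange BB) (aC : a \notin C) (bC : b \notin C) (ab : a != b).
Hypotheses (XB : a |: C \in BB) (YB : b |: C \in BB).

Lemma good_pair_adj c (x : {set E} * {set E}) : c \in C -> good_pair BB (C :\ c) a b c x ->
  [/\ link BB (fun B => a \in B) x, set_adj (a |: C) x.1,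
      set_adj x.2 (b |: C) & c \notin x.1].
Proof. by move=> cC; rewrite /good_pair !setD1K // => /and4P[]. Qed.

Lemma notin_setD1 c : c \notin C :\ c. Proof. by rewrite !inE eqxx. Qed.

Let aCD c : c \in C -> a \notin c |: C :\ c.
Proof. by move=> cC; rewrite setD1K. Qed.

Let bCD c : c \in C -> b \notin c |: C :\ c.
Proof. by move=> cC; rewrite setD1K. Qed.

Let indXB c : c \in C -> a |: (c |: C :\ c) \in BB.
Proof. by move=> cC; rewrite setD1K. Qed.

Let indYB c : c \in C -> b |: (c |: C :\ c) \in BB.
Proof. by move=> cC; rewrite setD1K. Qed.

Lemma pair_parallel c x : c \in C -> a |: (b |: C :\ c) \notin BB ->
  a |: (x |: C :\ c) \in BB -> x != c ->
  good_pair BB (C :\ c) a b c (a |: (x |: C :\ c), b |: (x |: C :\ c)).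
Proof.
move=> cC; exact: (good_pair_parallel ex (notin_setD1 c) (aCD cC) (bCD cC) ab
  (indXB cC) (indYB cC)).
Qed.

Lemma pair_link c x : c \in C -> a |: (b |: C :\ c) \in BB ->
  a |: (x |: C :\ c) \in BB -> x != c -> x != b ->
  exists D, good_pair BB (C :\ c) a b c (a |: (x |: C :\ c), D).
Proof.
move=> cC iab iax xc xb; eexists.
exact: (good_pair_link ex (notin_setD1 c) (aCD cC) (bCD cC) ab (indXB cC)
  (indYB cC) iab iax xc xb).
Qed.

Lemma pair_both c x : c \in C -> a |: (b |: C :\ c) \in BB ->
  b |: (x |: C :\ c) \in BB -> x != c -> x != a ->
  good_pair BB (C :\ c) a b c (a |: (b |: C :\ c), b |: (x |: C :\ c)).
Proof.
move=> cC; exact: (good_pair_both ex (notin_setD1 c) (aCD cC) (bCD cC) ab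
  (indXB cC)).
Qed.

Lemma pair_trans c x y z w : c \in C -> x |: (y |: C :\ c) \in BB ->
  z |: (w |: C :\ c) \in BB ->
  (x |: (z |: C :\ c) \in BB) || (y |: (z |: C :\ c) \in BB).
Proof.
move=> cC xy zw; rewrite setUCA [y |: _]setUCA.
exact: (nonparallel_trans ex (notin_setD1 c) (aCD cC) (indXB cC) xy zw).
Qed.

Lemma setD1K_other y x : y \notin C -> x \in C -> (y |: C) :\ x = y |: (C :\ x).
Proof.
move=> yC xC; apply/setP => z; rewrite !inE.
by have [->|//] := eqVneq z y; rewrite andbT; apply: contraNneq yC => ->.
Qed.

Lemma unique_part Y' (Q : pred {set E}) : Y' \in BB -> Q Y' ->
  (forall Z, Z \in BB -> Q Z -> Z = Y') -> part BB Q = [set Y'].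
Proof.
move=> YB' QY u; apply/setP => Z; rewrite !inE; apply/andP/eqP => [[]|->] //.
exact: u.
Qed.

(** A good pair suffices. If there is none, one part turns out to be a single basis, joined to
    itself by the trivial path, while the other part supplies a neighbour or is a single basis
    too. *)
Lemma split_edge : exists A D, [/\ link BB (fun B => a \in B) (A, D),
  joinable (part BB (fun B => a \in B)) (a |: C) A &
  joinable (part BB (fun B => a \notin B)) D (b |: C)].
Proof.
have [/existsP[c /andP[cC /existsP[[A D] g]]]|] :=
    boolP [exists c in C, exists x, good_pair BB (C :\ c) a b c x].
  exists A, D; case: (good_pair_adj cC g) => /= l XA DY _.
  by split=> //; apply: adj_joinable.
move=> nex.
have no c (x : {set E} * {set E}) : c \in C -> ~~ good_pair BB (C :\ c) a b c x.
  move=> cC; apply: contra nex => g; apply/existsP; exists c.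
  by rewrite cC; apply/existsP; exists x.
have aY : a \notin b |: C by rewrite !inE negb_or ab.
have joinX : part BB (fun B => a \in B) = [set a |: C] ->
    joinable (part BB (fun B => a \in B)) (a |: C) (a |: C).
  by move=> ->; rewrite /joinable !eqxx.
have joinY : part BB (fun B => a \notin B) = [set b |: C] ->
    joinable (part BB (fun B => a \notin B)) (b |: C) (b |: C).
  by move=> ->; rewrite /joinable !eqxx.
have aX : a \in a |: C by rewrite setU11.
have XY : set_adj (a |: C) (b |: C) by apply: set_adj_swap.
have [/exists_inP[Z ZB /andP[aZ ZY]]|nZ] :=
    boolP [exists Z in BB, (a \notin Z) && (Z != b |: C)].
  (* An exchange from [b |: C] towards [Z] must remove [b], since removing any other [y] would yield
     a good pair. *)
  have [z zC [za zb]] : exists2 z, z |: C \in BB & z != a /\ z != b.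
    have YZ : b |: C != Z by rewrite eq_sym.
    have [y yYZ] := exchange_subD ex YB ZB YZ.
    have [z zZY zYB] := ex YB ZB yYZ.
    move: yYZ zZY; rewrite !inE negb_or.
    move=> /andP[yZ yY] /andP[/andP[zb zC] zZ].
    have za : z != a by apply: contraNneq aZ => <-.
    have zy : z != y by apply: contraNneq yZ => <-.
    have [yb|yb] := eqVneq y b.
      by exists z => //; move: zYB; rewrite yb setU1K.
    have yC : y \in C by move: yY; rewrite (negPf yb).
    have bz : b |: (z |: C :\ y) \in BB by rewrite setUCA -setD1K_other.
    have [iab|iab] := boolP (a |: (b |: C :\ y) \in BB).
      have := pair_both yC iab bz zy za.
      by rewrite (negPf (no _ _ yC)).
    have := pair_trans yC bz (indXB yC).
    rewrite setUCA (negPf iab) setUCA /= => az.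
    have := pair_parallel yC iab az zy.
    by rewrite (negPf (no _ _ yC)).
  have zC' : z \notin C.
    apply/negP => zC'; have := exchange_card ex XB zC.
    by rewrite !cardsU1 aC zC' add0n => /esym/n_Sn.
  exists (a |: C), (z |: C); split.
  - apply/and5P; split=> //=; first by rewrite !inE negb_or eq_sym za.
    by apply: set_adj_swap; rewrite // eq_sym.
  (* A second basis containing [a] would allow an exchange of some [c] in [C] for some [w]; in the
     rank 2 minor at [c] either [w] or [z] would then yield a good pair. *)
  - apply: joinX; apply: unique_part => // W WB aW; apply/eqP; apply/negPn.
    rewrite eq_sym; apply/negP => XW; have [c cXW] := exchange_subD ex XB WB XW.
    have [w wWX wXB] := ex XB WB cXW.
    move: cXW wWX; rewrite !inE negb_or.
    move=> /andP[cW cX] /andP[/andP[wa wC] wW].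
    have ca : c != a by apply: contraNneq cW => ->.
    have wc : w != c by apply: contraNneq cW => <-.
    have cC : c \in C by move: cX; rewrite (negPf ca).
    have aw : a |: (w |: C :\ c) \in BB by rewrite setUCA -setD1K_other.
    have [iab|iab] := boolP (a |: (b |: C :\ c) \in BB); last first.
      have := pair_parallel cC iab aw wc.
      by rewrite (negPf (no _ _ cC)).
    have zc : z != c by apply: contraNneq zC' => ->.
    have izc : z |: (c |: C :\ c) \in BB by rewrite setD1K.
    have := pair_trans cC iab izc.
    case/orP => iz.
      have [D] := pair_link cC iab iz zc zb.
      by rewrite (negPf (no _ _ cC)).
    have := pair_both cC iab iz zc za.
    by rewrite (negPf (no _ _ cC)).
  - by apply: adj_joinable; apply: set_adj_swap.
have uY Z : Z \in BB -> a \notin Z -> Z = b |: C.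
  move=> ZB aZ; apply/eqP; apply: contraNT nZ => ZY.
  by apply/exists_inP; exists Z => //; rewrite aZ.
have jY := joinY (unique_part YB aY uY).
have [/exists_inP[W WB /andP[aW WX]]|nW] :=
    boolP [exists W in BB, (a \in W) && (W != a |: C)]; last first.
  exists (a |: C), (b |: C); split=> //; first exact/and5P.
  apply: joinX; apply: unique_part => // W WB aW; apply/eqP.
  by apply: contraNT nW => WX; apply/exists_inP; exists W => //; rewrite aW.
(* Removing [a] from [W] can only lead to [b |: C], the one basis without [a]; this forces [W] to be
   [a |: (b |: C :\ y)]. *)
have aWY : a \in W :\: (b |: C) by rewrite inE aY.
have [y yYW yWB] := ex WB YB aWY.
move: yYW; rewrite in_setD => /andP[yW yY].
have ya : y != a by apply: contraNneq yW => ->.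
have eqY : y |: W :\ a = b |: C.
  by apply: uY => //; rewrite !inE eqxx eq_sym (negPf ya).
have WaE : W :\ a = (b |: C) :\ y.
  by rewrite -eqY setU1K // !inE negb_and yW orbT.
have yb : y != b.
  apply: contraNneq WX => yb; rewrite -(setD1K aW) WaE yb setU1K //.
have yC : y \in C by move: yY; rewrite !inE (negPf yb).
have WE : W = a |: (b |: C :\ y) by rewrite -(setD1K aW) WaE setD1K_other.
have bD : b \notin C :\ y by rewrite !inE negb_and bC orbT.
have aD : a \notin C :\ y by rewrite !inE negb_and aC orbT.
exists W, (b |: C); split=> //.
  apply/and5P; split=> //=; rewrite WE -[X in set_adj _ (_ |: X)](setD1K yC).
  rewrite [b |: (y |: _)]setUCA; apply: set_adj_swap.
  - by rewrite !inE negb_or ab negb_and aC orbT.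
  - by rewrite !inE negb_or yb eqxx.
  - by rewrite eq_sym.
apply: adj_joinable; rewrite WE -[X in set_adj (_ |: X)](setD1K yC).
rewrite setUCA [a |: (b |: _)]setUCA; apply: set_adj_swap => //.
  by rewrite !inE eqxx negb_or ya.
by rewrite !inE negb_or negb_and bC eq_sym ab orbT.
Qed.

End Edge.

(** Induction on the number of bases: the part with [a] misses [Y] and the other misses [X], so both
    are smaller, and one link joins their paths. *)
Lemma hpaths_gt0 BB X Y : exchange BB -> X \in BB -> Y \in BB ->
  joinable BB X Y -> 0 < size (hpaths BB X Y).
Proof.
have [m] := ubnP #|BB|; elim: m BB X Y => // m IH BB X Y ltm ex XB YB.
rewrite /joinable; case: ifP => [/eqP<- /eqP->|_ XY]; first by rewrite hpaths1.
have [C [a [b [XE YE aC bC ab]]]] := set_adjP (exchange_card ex XB YB) XY.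
rewrite XE YE in XB YB *.
have aX : a \in a |: C by rewrite setU11.
have aY : a \notin b |: C by rewrite !inE negb_or ab.
have [A [D [l jA jD]]] := split_edge ex aC bC ab XB YB.
have lAD : all (link BB (fun B => a \in B)) [:: (A, D)] by rewrite /= l.
case/and5P: l => /= AB aA DB aD AD.
have ltp Q Z : Z \in BB -> ~~ Q Z -> #|part BB Q| < m.
  move=> ZB nQ; apply: leq_trans (_ : #|BB| <= m) => //; apply: proper_card.
  apply/properP; split; last by exists Z; rewrite // inE ZB.
  by apply/subsetP => U; rewrite inE => /andP[].
apply: leq_trans (splice_bound (m1 := 1) (m2 := 1) XB aX lAD _ _ _) => //;
  move=> _ /predU1P[->|//] /=; apply: IH => //; rewrite ?mem_part ?XB ?AB ?DB ?YB //.
- exact: (ltp (fun B => a \in B) (b |: C)).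
- exact: exchange_part_in.
- by apply: (ltp (fun B => a \notin B) (a |: C)); rewrite // negbK.
- exact: exchange_part_notin.
Qed.

End Splitting.

(** * Double counting of linking pairs *)

Section Counting.
Variable E : finType.
Implicit Types (A B C D S W X Y Z I : {set E}) (a b c : E).
Implicit Types (BB : {set {set E}}).

Definition edge_pairs BB a X Y := [set x : {set E} * {set E} |
  [&& link BB (fun B => a \in B) x, set_adj X x.1 & set_adj x.2 Y]].

Lemma edge_pairs_bound BB a X Y m1 m2 : X \in BB -> a \in X ->
  (forall A, A \in BB -> a \in A -> set_adj X A ->
     m1 <= size (hpaths (part BB (fun B => a \in B)) X A)) ->
  (forall D, D \in BB -> a \notin D -> set_adj D Y ->
     m2 <= size (hpaths (part BB (fun B => a \notin B)) D Y)) ->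
  #|edge_pairs BB a X Y| * (m1 * m2) <= size (hpaths BB X Y).
Proof.
move=> XB aX h1 h2; rewrite cardE; apply: (splice_bound (Q := fun B => a \in B)) => //.
- by apply/allP => x; rewrite mem_enum inE => /and3P[].
- exact: enum_uniq.
- move=> x; rewrite mem_enum inE => /and3P[/and5P[? ? _ _ _] ? _].
  exact: h1.
- move=> x; rewrite mem_enum inE => /and3P[/and5P[_ _ ? ? _] _ ?].
  exact: h2.
Qed.

Section Edge.
Variables (BB : {set {set E}}) (C : {set E}) (a b : E).
Hypotheses (ex : exchange BB) (aC : a \notin C) (bC : b \notin C) (ab : a != b).
Hypotheses (XB : a |: C \in BB) (YB : b |: C \in BB).

(** The incidences between [c] in [U] and pairs [x] with [c \notin x.1] are counted twice: [x.1]
    contains [a] and is one exchange away from [a |: C], so it misses exactly one element of [C]. *)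
Lemma edge_pairs_count (U : {set E}) m : U \subset C ->
  (forall c, c \in U -> m <= #|[set x | good_pair BB (C :\ c) a b c x]|) ->
  #|U| * m <= #|edge_pairs BB a (a |: C) (b |: C)|.
Proof.
move=> UC h; set P := edge_pairs _ _ _ _.
apply: leq_trans (_ : \sum_(c in U) \sum_(x in P) (c \notin x.1) <= _).
  rewrite -sum_nat_const; apply: leq_sum => c cU; apply: leq_trans (h c cU) _.

  have -> : \sum_(x in P) (c \notin x.1) = #|[set x in P | c \notin x.1]|.
    rewrite -sum1_card; under [RHS]eq_bigl do rewrite inE.
    by rewrite big_mkcondr; apply: eq_bigr => x _; case: (c \in _).
  apply/subset_leq_card/subsetP => x.
  rewrite !inE => /(good_pair_adj (subsetP UC _ cU))[l XA DY cA].
  by rewrite l XA DY.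
rewrite exchange_big /= -sum1_card; apply: leq_sum => x.
rewrite inE => /and3P[/and5P[AB aA _ _ _] XA _].
have [S [u [v [XE AE uS vS uv]]]] := set_adjP (exchange_card ex XB AB) XA.
have ua : a != u.
  apply: contraTneq aA => ->; rewrite AE !inE negb_or uv.
  by [].
rewrite (eq_bigr (fun c => nat_of_bool (c == u))) => [|c cU]; last first.
  have : c \in a |: C by rewrite !inE (subsetP UC) ?orbT.
  rewrite XE AE !inE; have [->|_] := eqVneq c u.
    by rewrite (negPf uv) (negPf uS).
  by move=> /= ->; rewrite orbT.
have [uU|uU] := boolP (u \in U).
  rewrite (bigD1 u) //= eqxx big1 // => c /andP[_ /negPf->] //.
rewrite big1 // => c cU; case: eqP => // cu; by rewrite -cu cU in uU.
Qed.

(** One link along [a] and one along [b] give [m] paths each, as the contraction contributes [m] and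
    the deletion at least one. The basis [W] keeps the two families disjoint. *)
Lemma two_sided c (x : E) W m : c \in C -> a |: (x |: C :\ c) \in BB ->
  x != c -> x != b -> W \in BB -> a \in W -> b \in W ->
  (forall A, A \in BB -> a \in A -> set_adj (a |: C) A ->
     m <= size (hpaths (part BB (fun B => a \in B)) (a |: C) A)) ->
  (forall D, D \in BB -> b \in D -> set_adj (b |: C) D ->
     m <= size (hpaths (part BB (fun B => b \in B)) (b |: C) D)) ->
  2 * m <= size (hpaths BB (a |: C) (b |: C)).
Proof.
move=> cC ax xc xb WB aW bW ha hb.
have aD : a \notin C :\ c by rewrite !inE negb_and aC orbT.
have bD : b \notin C :\ c by rewrite !inE negb_and bC orbT.
have bt : b \notin a |: (x |: C :\ c).
  by rewrite in_setU1 in_setU1 !negb_or eq_sym ab eq_sym xb.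
(* Both links start from [a |: (x |: C :\ c)]. If [a] and [b] are independent, the one along [b] is
   a reversed pair from [pair_both] with [a] and [b] swapped; otherwise the same link serves
   twice. *)
have [D [A' [D' [g bA' bD' [A'B D'B XA' A'D' D'Y]]]]] : exists D A' D',
   [/\ good_pair BB (C :\ c) a b c (a |: (x |: C :\ c), D), b \notin A', b \in D' &
   [/\ A' \in BB, D' \in BB, set_adj (a |: C) A', set_adj A' D'
     & set_adj D' (b |: C)]].
  have [iab|iab] := boolP (a |: (b |: C :\ c) \in BB).
    have [D g] := pair_link ex aC bC ab XB YB cC iab ax xc xb.
    have iba : b |: (a |: C :\ c) \in BB by rewrite setUCA.
    have xa : x != a.
      apply: contraTneq ax => ->; apply/negP => /(exchange_card ex XB).
      by rewrite setUA setUid !cardsU1 aC aD (cardsD1 c C) cC => /esym/n_Sn.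
    have ba : b != a by rewrite eq_sym.
    have := pair_both ex bC aC ba YB cC iba ax xc xb.
    case/(good_pair_adj cC) => /and5P[/= D'B _ A'B _ AD] YD AX _.
    exists D, (a |: (x |: C :\ c)), (b |: (a |: C :\ c)); split=> //.
      exact: setU11.
    by split; rewrite // set_adj_sym.
  have g := pair_parallel ex aC bC ab XB YB cC iab ax xc.
  case/(good_pair_adj cC): (g) => /and5P[/= AB _ DB _ AD] XA DY _.
  exists (b |: (x |: C :\ c)), (a |: (x |: C :\ c)), (b |: (x |: C :\ c)).
  by split=> //; apply: setU11.
have [/= l XA DY _] := good_pair_adj cC g.
have lP : all (link BB (fun B => a \in B)) [:: (a |: (x |: C :\ c), D)].
  by rewrite /= l.
have lP' : all (link BB (fun B => b \notin B)) [:: (A', D')].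
  by rewrite /= andbT; apply/and5P; split; rewrite //= negbK.
have aX : a \in a |: C by rewrite setU11.
have bX : b \notin a |: C by rewrite !inE negb_or eq_sym ab.
have aY : a \notin b |: C by rewrite !inE negb_or ab.
case/and5P: l => /= AB aA DB aD' _.
set L1 := splices BB (fun B => a \in B) (a |: C) (b |: C)
  [:: (a |: (x |: C :\ c), D)].
set L2 := splices BB (fun B => b \notin B) (a |: C) (b |: C) [:: (A', D')].
have s1 : m <= size L1.
  have := size_splices (BB := BB) (Q := fun B => a \in B) (X := a |: C)
   (Y := b |: C) (P := [:: (a |: (x |: C :\ c), D)]) (m1 := m) (m2 := 1).
  rewrite mul1n muln1; apply; move=> _ /predU1P[->|//] /=.
    exact: ha.
  apply: hpaths_gt0; rewrite ?mem_part ?DB ?YB //.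
    exact: exchange_part_notin.
  exact: adj_joinable.
have partE : part BB (fun B => ~~ (b \notin B)) = part BB (fun B => b \in B).
  by apply/setP => Z; rewrite !mem_part negbK.
have bY : b \in b |: C by rewrite setU11.
have s2 : m <= size L2.
  have := size_splices (BB := BB) (Q := fun B => b \notin B) (X := a |: C)
   (Y := b |: C) (P := [:: (A', D')]) (m1 := 1) (m2 := m).
  rewrite !mul1n; apply; move=> _ /predU1P[->|//] /=.
    apply: hpaths_gt0; rewrite ?mem_part ?A'B ?XB //.
      exact: exchange_part_notin.
    exact: adj_joinable.
  (* [hb] is about paths that start at [b |: C], whereas these end there. *)
  rewrite partE; apply: leq_trans (hpaths_rev _ _);
    rewrite ?mem_part ?D'B ?YB //.
  by apply: hb; rewrite // set_adj_sym.
apply: leq_trans (_ : size (L2 ++ L1) <= _).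
  by rewrite size_cat mul2n -addnn leq_add.
apply: uniq_leq_size.
  rewrite cat_uniq !splices_uniq //= andbT has_sym.
  apply: (@splices_disjoint _ BB _ _ _ _ a b W) => //.
  by move=> z; rewrite mem_seq1 => /eqP->.
move=> s; rewrite mem_cat => /orP[]; exact: splices_sub.
Qed.

End Edge.
End Counting.

(** * The lower bound for matroids *)

(* The bound for rank [r.+1] and cogirth at least [k.+2]. *)
Fixpoint path_bound (r : nat) : nat -> nat :=
  match r with
  | 0 => factorial
  | r'.+1 => fix bound_r k := match k with
             | 0 => 2 ^ r'
             | k'.+1 => r'.+1 * k'.+2 * (path_bound r' k'.+1 * bound_r k')
             end
  end.

Section Framed.
Variable E : finType.
Implicit Types (A B C D S W X Y Z I : {set E}) (a b c d x y z : E).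
Implicit Types (BB : {set {set E}}).

(* [BB] are the bases of a matroid in which [I] has been contracted (so that
   every basis is made to contain [I]), of rank [r] and cogirth at least [k]:
   [extensions BB (B :\ c)] is the fundamental cocircuit of [c] in [B]. *)
Definition framed BB I r k := [/\ exchange BB,
  forall B, B \in BB -> I \subset B /\ #|B| = #|I| + r &
  forall S c, c \notin S -> c |: S \in BB -> c \notin I ->
    k <= #|extensions BB S|].

(** The cocircuits concerned do not shrink: [c] differs from [a], so [a] lies in [S] and every
    extension of [S] contains it. *)
Lemma framed_contract BB I r k a : framed BB I r.+1 k -> a \notin I ->
  framed (part BB (fun B => a \in B)) (a |: I) r k.
Proof.
case=> ex fr co aI; split; first exact: exchange_part_in.
  move=> B; rewrite mem_part => /andP[/fr[IB cB] aB]; split.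
    by rewrite subUset sub1set aB.
  by rewrite cardsU1 aI cB addnS add1n.
move=> S c cS; rewrite mem_part => /andP[cSB acS].
rewrite in_setU1 negb_or => /andP[ca cI].
have aS : a \in S by move: acS; rewrite in_setU1 eq_sym (negPf ca).
apply: leq_trans (co _ _ cS cSB cI) _.
apply/subset_leq_card/subsetP => x; rewrite !inE => ->.
by rewrite aS orbT.
Qed.

(** A cocircuit loses at most the element [a]. *)
Lemma framed_delete BB I r k a : framed BB I r k.+1 ->
  framed (part BB (fun B => a \notin B)) I r k.
Proof.
case=> ex fr co; split; first exact: exchange_part_notin.
  by move=> B; rewrite mem_part => /andP[/fr].
move=> S c cS; rewrite mem_part => /andP[cSB acS] cI.
apply: leq_trans (card_setD1_geq a (co _ _ cS cSB cI)) _.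
apply/subset_leq_card/subsetP => x; rewrite !inE => /andP[xa ->] /=.
by move: acS; rewrite in_setU1 !negb_or [a == x]eq_sym xa => /andP[].
Qed.

(** Every basis is [I] with one more element, so any two are adjacent, and the bases other than [X]
    and [Y], at least [k] in number, may be visited in any order. *)
Lemma hpaths_rank1 BB I k X Y : framed BB I 1 k.+2 -> X \in BB -> Y \in BB ->
  set_adj X Y -> k`! <= size (hpaths BB X Y).
Proof.
case=> ex fr co XB YB XY.
have oneE B x : B \in BB -> x \in B -> x \notin I -> B = x |: I.
  move=> BB' xB xI; have [IB cB] := fr B BB'.
  apply/eqP; rewrite eq_sym eqEcard subUset sub1set xB IB cardsU1 xI cB addnC.
  by rewrite leqnn.
have adj A B : A \in BB -> B \in BB -> A != B -> set_adj A B.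
  move=> AB BB' nAB; have [x] := exchange_subD ex AB BB' nAB.
  rewrite eq_sym in nAB; have [y] := exchange_subD ex BB' AB nAB.
  rewrite !inE => /andP[yA yB] /andP[xB xA].
  have [/subsetP IA _] := fr A AB; have [/subsetP IB _] := fr B BB'.
  have xI := contra (IB x) xB; have yI := contra (IA y) yA.
  rewrite (oneE _ x AB) // (oneE _ y BB') //; apply: set_adj_swap => //.
  by apply: contraNneq yA => <-.
have extI x : x \in extensions BB I -> x \notin I.
  rewrite inE => xIB; apply/negP => xI; have [_] := fr _ xIB.
  by rewrite cardsU1 xI addn1 => /n_Sn.
have cBB : k.+2 <= #|BB|.
  have [x xXY] := exchange_subD ex XB YB (set_adj_neq XY).
  move: xXY; rewrite inE => /andP[xY xX].
  have xI : x \notin I by apply: contra xY; apply/subsetP; case: (fr Y YB).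
  have xIB : x |: I \in BB by rewrite -(oneE X).
  apply: leq_trans (co I x xI xIB xI) _.
  rewrite -(card_in_imset (f := fun x => x |: I)); last first.
    by move=> u v /extI uI _; apply: setU1_inj.
  by apply/subset_leq_card/subsetP => _ /imsetP[u + ->]; rewrite inE.
set T := BB :\ X :\ Y.
have cT : k <= #|T| by rewrite !card_setD1_geq.
apply: leq_trans (_ : #|T|`! <= _); first exact: leq_fact.
have -> : #|T|`! = size [seq rcons s Y | s <- permutations (enum T)].
  by rewrite size_map size_permutations ?enum_uniq // -cardE.
apply: uniq_leq_size.
  by rewrite map_inj_uniq ?permutations_uniq //; apply: rcons_injl.
move=> _ /mapP[s + ->]; rewrite mem_permutations => ps.
have YX : Y != X by rewrite eq_sym set_adj_neq.
have sT Z : (Z \in s) = (Z \in T) by rewrite (perm_mem ps) mem_enum.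
have us : uniq (X :: rcons s Y).
  rewrite /= rcons_uniq mem_rcons inE !sT (perm_uniq ps) enum_uniq !inE !eqxx.
  by rewrite eq_sym (negPf YX) !andbF.
have mE : X :: rcons s Y =i BB.
  move=> Z; rewrite inE mem_rcons inE sT !inE.
  have [->|_] := eqVneq Z X; first by rewrite XB.
  by have [->|_] := eqVneq Z Y; rewrite ?YB.
apply/hpathsP => //; split=> //; last by rewrite last_rcons.
have : pairwise (@set_adj E) (X :: rcons s Y).
  move: us; rewrite uniq_pairwise; apply: (@sub_in_pairwise _ (mem BB)).
    by move=> A B AB BB'; apply: adj.
  by apply/allP => Z; rewrite mE.
exact: (@pairwise_sorted _ _ (X :: rcons s Y)).
Qed.

Section FramedEdge.
Variables (BB : {set {set E}}) (I C : {set E}) (a b : E) (r k : nat).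
Hypotheses (frB : framed BB I r.+1 k) (aC : a \notin C) (bC : b \notin C).
Hypotheses (ab : a != b) (XB : a |: C \in BB) (YB : b |: C \in BB).

Let ex : exchange BB. Proof. by case: frB. Qed.

Lemma frame_sub B : B \in BB -> I \subset B.
Proof. by case: frB => _ fr _ /fr[]. Qed.

Lemma frame_subC : I \subset C.
Proof.
apply/subsetP => x xI; have := subsetP (frame_sub YB) x xI.
have := subsetP (frame_sub XB) x xI; rewrite !inE.
by case: eqVneq => //= ->; rewrite (negPf ab) (negPf aC).
Qed.

Lemma frame_notin : a \notin I.
Proof. by apply: contra aC; apply/subsetP/frame_subC. Qed.

Lemma card_freeC : #|C :\: I| = r.
Proof.
case: frB => _ fr _; have [_] := fr _ XB.
rewrite cardsU1 aC addnS add1n => -[cC].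
by rewrite cardsD (setIidPr frame_subC) cC addKn.
Qed.

Lemma frame_cocircuit c : c \in C :\: I ->
  k <= #|extensions BB (a |: C :\ c)|.
Proof.
rewrite inE => /andP[cI cC]; case: frB => _ _ co.
have caC : c \notin a |: C :\ c.
  by rewrite !inE eqxx orbF; apply: contraNneq aC => <-.
by apply: (co _ c); rewrite // setUCA setD1K.
Qed.

Lemma frame_other c : 1 < k -> c \in C :\: I ->
  exists2 x, a |: (x |: C :\ c) \in BB & x != c.
Proof.
move=> k1 cCI; have := leq_trans k1 (frame_cocircuit cCI).
rewrite (cardsD1 c) => lt1.
have : 0 < #|extensions BB (a |: C :\ c) :\ c|.
  by move: lt1; case: (c \in _) => // /ltnW.
case/card_gt0P => x; rewrite !inE => /andP[xc xB]; exists x => //.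
by rewrite setUCA.
Qed.

End FramedEdge.

(* The linking pairs may be too few to double the count from one rank to the
   next; then the paths spliced along [b] are added to those spliced along [a],
   unless [BB] has only one basis without [a], which any neighbour of [X]
   containing both [a] and [b] can be linked to. *)
Lemma hpaths_cogirth2 r BB I X Y : framed BB I r.+1 2 -> X \in BB -> Y \in BB ->
  set_adj X Y -> 2 ^ r.-1 <= size (hpaths BB X Y).
Proof.
elim: r BB I X Y => [|[|r] IH] BB I X Y fr XB YB XY.
- by apply: hpaths_gt0 => //; [case: fr | apply: adj_joinable].
- by apply: hpaths_gt0 => //; [case: fr | apply: adj_joinable].
rewrite /= expnS; have ex : exchange BB by case: fr.
have [C [a [b [XE YE aC bC ab]]]] := set_adjP (exchange_card ex XB YB) XY.
rewrite XE YE in XB YB XY *.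
have ba : b != a by rewrite eq_sym.
have aI := frame_notin fr aC ab XB YB.
have bI := frame_notin fr bC ba YB XB.
have cU := card_freeC fr aC ab XB YB.
have aX : a \in a |: C by rewrite setU11.
have bY : b \in b |: C by rewrite setU11.
have aY : a \notin b |: C by rewrite !inE negb_or ab.
have bX : b \notin a |: C by rewrite !inE negb_or ba.
have IHa A : A \in BB -> a \in A -> set_adj (a |: C) A ->
    2 ^ r <= size (hpaths (part BB (fun B => a \in B)) (a |: C) A).
  move=> AB aA; apply: (IH _ (a |: I) _ _ (framed_contract fr aI));
  by rewrite mem_part ?XB ?AB.
have IHb A : A \in BB -> b \in A -> set_adj (b |: C) A ->
    2 ^ r <= size (hpaths (part BB (fun B => b \in B)) (b |: C) A).
  move=> AB bA; apply: (IH _ (b |: I) _ _ (framed_contract fr bI));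
  by rewrite mem_part ?YB ?AB.
have subC c : c \in C :\: I -> c \in C by rewrite inE => /andP[].
(* If [a] and [b] are parallel for every [c], each of the [r.+2] choices of [c] supplies a link,
   which is enough to double the count. *)
have [/exists_inP[c1 c1U iab]|nex] :=
    boolP [exists c in C :\: I, a |: (b |: C :\ c) \in BB]; last first.
  have pos c : c \in C :\: I -> 1 <= #|[set x | good_pair BB (C :\ c) a b c x]|.
    move=> cU'; have [x ax xc] := frame_other fr aC XB isT cU'.
    have nab : a |: (b |: C :\ c) \notin BB.
      by apply: contra nex => iab; apply/exists_inP; exists c.
    apply/card_gt0P; exists (a |: (x |: C :\ c), b |: (x |: C :\ c)).
    by rewrite inE; apply: pair_parallel => //; apply: subC.
  have := edge_pairs_count ex XB (subsetDl C I) pos.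
  rewrite muln1 cU => cP.
  have := edge_pairs_bound (BB := BB) (X := a |: C) (Y := b |: C) (m2 := 1)
    XB aX IHa.
  rewrite muln1 => h; apply: leq_trans (h _).
    by rewrite leq_mul // (leq_trans _ cP).
  move=> D DB aD DY; apply: hpaths_gt0; rewrite ?mem_part ?DB ?YB //.
    exact: exchange_part_notin.
  exact: adj_joinable.
have aW : a \in a |: (b |: C :\ c1) by rewrite setU11.
have bW : b \in a |: (b |: C :\ c1) by rewrite setUCA setU11.
(* Some basis contains both [a] and [b]. If a further element is available on either side,
   [two_sided] applies, on the side of [b] after reversal. *)
have [/exists_inP[c cCI /existsP[x /and3P[ax xc xb]]]|na] :=
  boolP [exists c in C :\: I, exists x,
   [&& a |: (x |: C :\ c) \in BB, x != c & x != b]].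
  exact: (two_sided ex aC bC ab XB YB (subC _ cCI) ax xc xb iab aW bW IHa IHb).
have [/exists_inP[c cCI /existsP[x /and3P[bx xc xa]]]|nb] :=
  boolP [exists c in C :\: I, exists x,
   [&& b |: (x |: C :\ c) \in BB, x != c & x != a]].
  apply: leq_trans (hpaths_rev _ _) => //.
  exact: (two_sided ex bC aC ba YB XB (subC _ cCI) bx xc xa iab bW aW IHb IHa).
(* What remains: in the rank 2 minor at each [c], [a] is independent of at most [b] and [c], and [b]
   of at most [a] and [c]. *)
have {}na c x : c \in C :\: I -> a |: (x |: C :\ c) \in BB -> x != c -> x = b.
  move=> cCI ax xc; apply/eqP; apply: contraNT na => xb; apply/exists_inP.
  by exists c => //; apply/existsP; exists x; apply/and3P.
have {}nb c x : c \in C :\: I -> b |: (x |: C :\ c) \in BB -> x != c -> x = a.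
  move=> cCI ax xc; apply/eqP; apply: contraNT nb => xb; apply/exists_inP.
  by exists c => //; apply/existsP; exists x; apply/and3P.
have partY : part BB (fun B => a \notin B) = [set b |: C].
  apply: unique_part => // Z ZB aZ; apply/eqP/negPn; rewrite eq_sym.
  apply/negP => YZ.
  have [y yYZ] := exchange_subD ex YB ZB YZ.
  have [z zZY zYB] := ex _ _ _ YB ZB yYZ.
  move: yYZ zZY; rewrite !inE negb_or => /andP[yZ yY] /andP[/andP[zb zC] zZ].
  have za : z != a by apply: contraNneq aZ => <-.
  have zy : z != y by apply: contraNneq yZ => <-.
  have [yb|yb] := eqVneq y b; last first.
    have yC : y \in C by move: yY; rewrite (negPf yb).
    have yI : y \notin I.
      by apply: contra yZ; apply/subsetP; apply: (frame_sub fr).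
    have bz : b |: (z |: C :\ y) \in BB by rewrite setUCA -setD1K_other.
    move: za; rewrite (nb _ _ _ bz zy) ?eqxx //.
    by rewrite inE yI.
  have zc1 : z != c1 by apply: contraNneq zC => ->; apply: subC.
  have zCB : z |: (c1 |: C :\ c1) \in BB.
    by rewrite setD1K ?subC //; move: zYB; rewrite yb setU1K.
  have := pair_trans ex aC XB (subC _ c1U) iab zCB.
  case/orP=> iz.
    by move: zb; rewrite (na _ _ c1U iz zc1) eqxx.
  by move: za; rewrite (nb _ _ c1U iz zc1) eqxx.
(* Each of the [r.+2] elements [c] gives a link into [b |: C], the only basis without [a]. *)
pose P := [seq (a |: (b |: C :\ c), b |: C) | c <- enum (C :\: I)].
have bothE c : c \in C :\: I -> a |: (b |: C :\ c) \in BB.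
  move=> cCI; have [x ax xc] := frame_other fr aC XB isT cCI.
  by rewrite -(na _ _ cCI ax xc).
have uP : uniq P.
  rewrite map_inj_in_uniq ?enum_uniq // => c d; rewrite !mem_enum => /subC cC.
  move=> _ [] /setP/(_ c); rewrite !inE eqxx cC andbT /= orbF.
  have /negPf-> : c != a by apply: contraNneq aC => <-.
  have /negPf-> : c != b by apply: contraNneq bC => <-.
  by rewrite /= andbT => /esym/negbFE/eqP.
have adjs c : c \in C ->
    set_adj (a |: C) (a |: (b |: C :\ c)) /\
    set_adj (a |: (b |: C :\ c)) (b |: C).
  move=> cC.
  have ca : c != a by apply: contraNneq aC => <-.
  have cb : c != b by apply: contraNneq bC => <-.
  have aE : a |: C = c |: (a |: C :\ c) by rewrite setUCA setD1K.
  have bE : b |: C = c |: (b |: C :\ c) by rewrite setUCA setD1K.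
  rewrite aE bE (setUCA [set a] [set b]); split.
    apply: set_adj_swap; rewrite // !inE ?eqxx ?(negPf ca) ?(negPf ba) //.
    by rewrite (negPf bC) andbF.
  rewrite (setUCA [set b] [set a]).
  apply: set_adj_swap; rewrite 1?eq_sym // !inE ?eqxx ?(negPf ab) ?(negPf cb) //.
  by rewrite (negPf aC) andbF.
have lP : all (link BB (fun B => a \in B)) P.
  apply/allP => _ /mapP[c + ->]; rewrite mem_enum => cCI.
  by apply/and5P; split; rewrite //= ?bothE ?setU11 //; case: (adjs c (subC _ cCI)).
have := splice_bound (Y := b |: C) (m1 := 2 ^ r) (m2 := 1) XB aX lP uP.
rewrite size_map -cardE cU muln1 => h; apply: leq_trans (h _ _).
- by rewrite leq_mul.
- move=> _ /mapP[c + ->] /=; rewrite mem_enum => cCI.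
  by apply: IHa; rewrite ?bothE ?setU11 //; case: (adjs c (subC _ cCI)).
- by move=> _ /mapP[c _ ->] /=; rewrite partY hpaths1.
Qed.

(** Double induction: contraction lowers the rank, deletion the cogirth. In the inductive step
    cocircuits of size at least [k.+3] give [k.+2] good pairs for each of the [r.+1] elements of
    [C :\: I], whence the coefficient in [path_bound]. *)
Lemma hpaths_framed r k BB I X Y : framed BB I r.+1 k.+2 ->
  X \in BB -> Y \in BB -> set_adj X Y ->
  path_bound r k <= size (hpaths BB X Y).
Proof.
elim: r k BB I X Y => [|r IHr] k; first by move=> BB I X Y; apply: hpaths_rank1.
elim: k => [|k IHk] BB I X Y fr XB YB XY.
  exact: (hpaths_cogirth2 fr XB YB XY).
have ex : exchange BB by case: fr.
have [C [a [b [XE YE aC bC ab]]]] := set_adjP (exchange_card ex XB YB) XY.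
rewrite XE YE in XB YB XY *.
have ba : b != a by rewrite eq_sym.
have aI := frame_notin fr aC ab XB YB.
have cU := card_freeC fr aC ab XB YB.
have aX : a \in a |: C by rewrite setU11.
have aY : a \notin b |: C by rewrite !inE negb_or ab.
have good c : c \in C :\: I ->
    k.+2 <= #|[set x | good_pair BB (C :\ c) a b c x]|.
  move=> cCI; have cC : c \in C by move: cCI; rewrite inE => /andP[].
  apply: (card_good_pairs ex); rewrite ?setD1K ?notin_setD1 //.
    exact: (frame_cocircuit fr).
  exact: (frame_cocircuit fr).
have := edge_pairs_count ex XB (subsetDl C I) good; rewrite cU => cP.
apply: leq_trans (_ : #|edge_pairs BB a (a |: C) (b |: C)| *
  (path_bound r k.+1 * path_bound r.+1 k) <= _).
  by rewrite leq_mul2r cP orbT.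
apply: edge_pairs_bound => //.
  move=> A AB aA; apply: (IHr _ _ (a |: I)); rewrite ?mem_part ?XB ?AB //.
  exact: framed_contract.
move=> D DB aD; apply: (IHk _ I); rewrite ?mem_part ?DB ?YB //.
exact: framed_delete.
Qed.

End Framed.

(** * From Hamiltonian paths to Hamiltonian cycles *)

Section CycleEdges.
Variable T : finType.
Implicit Types (x : T) (p q : seq T).

(** At [i = size p] the default value [x] of [nth] is the right one, the successor of the last
    vertex. *)
Lemma next_nthS x p i : uniq (x :: p) -> i <= size p ->
  next (x :: p) (nth x (x :: p) i) = nth x p i.
Proof. by move=> up ip; rewrite next_nth mem_nth // index_uniq. Qed.

Lemma mem_cycle_edges x p i : uniq (x :: p) -> i <= size p ->
  [set nth x (x :: p) i; nth x p i] \in cycle_edges (x :: p).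
Proof.
move=> up ip; apply/imsetP; exists (nth x (x :: p) i); first exact: mem_nth.
by rewrite next_nthS.
Qed.

(* The edge from the last vertex back to [x] fixes an orientation, after which
   every vertex determines its successor. *)
Lemma cycle_edges_inj x p q : uniq (x :: p) -> uniq (x :: q) ->
  size p = size q -> 1 < size p -> last x p = last x q ->
  cycle_edges (x :: p) = cycle_edges (x :: q) -> p = q.
Proof.
move=> up uq spq p1 lpq epq; apply: (@eq_from_nth _ x) => // i.
have [n] := ubnP i; elim: n i => // n IH i; rewrite ltnS => lin ip.
have cE : nth x (x :: p) i = nth x (x :: q) i.
  by case: i lin ip => // i lin ip; apply: IH => //; apply: ltnW.
have ip' := ltnW ip.
have := mem_cycle_edges up ip'.
rewrite epq => /imsetP[_ /(nthP x)[j jq <-] eE].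
rewrite next_nthS // in eE.
have iq : i < size (x :: q) by rewrite /= ltnS -spq.
have i1p : i.+1 < size (x :: p) by [].
have ipp : i < size (x :: p) by rewrite /= ltnS.
have c1E : nth x p i = nth x (x :: p) i.+1 by [].
have nci : nth x p i != nth x (x :: p) i.
  by rewrite c1E nth_uniq // neq_ltn ltnSn orbT.
have : nth x (x :: p) i \in [set nth x (x :: q) j; nth x q j].
  by rewrite -eE set21.
have : nth x p i \in [set nth x (x :: q) j; nth x q j].
  by rewrite -eE set22.
rewrite !in_set2 => e1 /orP[/eqP e2|/eqP e2].
  have /eqP ij : i == j by rewrite -(nth_uniq x iq jq uq) -cE e2.
  by move: e1; rewrite -e2 (negPf nci) /= ij => /eqP.
move: e1; rewrite -e2 (negPf nci) orbF => /eqP e1.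
(* Here [q] traverses the edge backwards. If it is not the closing edge of [q], then [p] would
   return to the vertex at [j], which it has already visited. *)
have [jq'|jq'] := ltnP j (size q).
  have j1q : j.+1 < size (x :: q) by [].
  have /eqP ij : i == j.+1 by rewrite -(nth_uniq x iq j1q uq) -cE e2.
  have jp : j < size (x :: p) by rewrite /= spq.
  have : nth x p i == nth x (x :: p) j.
    rewrite e1; case: (j) ij => // j' ij /=; rewrite IH //.
      by apply: leq_trans lin; rewrite ij ltnW.
    by apply: leq_trans ip; rewrite ij ltnS leqW.
  by rewrite c1E nth_uniq // ij eqn_leq ltnNge leqnSn.
(* For the closing edge of [q], [nth] gives its default [x]; hence [i = 0], and [p] would begin with
   its last vertex, against [1 < size p]. *)
have jE : j = size q by apply/eqP; rewrite eqn_leq jq' -ltnS jq.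
move: e2; rewrite jE [nth x q _]nth_default // => e2.
have /eqP i0 : i == 0 by rewrite -(nth_uniq x ipp (ltn0Sn _) up) e2.
have : nth x (x :: p) 1 == nth x (x :: p) (size p).
  by rewrite -last_nth lpq (last_nth x) -jE -e1 i0.
rewrite nth_uniq //; last exact: ltnW.
by case: (size p) p1 => [|[]].
Qed.

End CycleEdges.

Section BasisGraphBound.
Variables (E : finType) (M : matroid E).

(** Each path is closed by the edge from [y] back to [x]. As all paths share both ends,
    [cycle_edges_inj] shows that different paths give different cycles. *)
Lemma hpaths_le_HC (x y : basis M) : basis_adj x y -> 2 < #|bases M| ->
  size (hpaths (bases M) (val x) (val y)) <= HC [set x; y].
Proof.
move=> xy c3.
pose f p : seq (basis M) := pmap insub p.
have fK p : p \in hpaths (bases M) (val x) (val y) -> map val (f p) = p.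
  case/(hpathsP _ _ (valP x)) => _ pm _ _.
  rewrite /f (pmap_filter (insubK _)); apply/all_filterP/allP => Z Zp.
  by rewrite /=; case: insubP => //; rewrite -pm inE Zp orbT.
rewrite -(size_map (fun p => cycle_edges (x :: f p))).
have props p : p \in hpaths (bases M) (val x) (val y) ->
   [/\ uniq (x :: f p), x :: f p =i predT, path (@basis_adj _ M) x (f p),
      last x (f p) = y & size (x :: f p) = #|bases M|].
  move=> pH; have pE := fK p pH; case/(hpathsP _ _ (valP x)): pH => up pm pp lp.
  have mE : map val (x :: f p) = val x :: p by rewrite /= pE.
  split.
  - by rewrite -(map_inj_uniq val_inj) mE.
  - by move=> z; rewrite -(mem_map val_inj) mE pm (valP z).
  - by move: pp; rewrite -{1}pE path_map.
  - by apply: val_inj; rewrite -last_map pE.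
  - by rewrite -(size_map val) mE -(card_uniqP up); apply: eq_card.
set L := map _ _; have /card_uniqP <- : uniq L.
  rewrite map_inj_in_uniq ?hpaths_uniq // => p q pH qH ee.
  have [up mp _ lp sp] := props p pH; have [uq mq _ lq sq] := props q qH.
  rewrite -(fK p pH) -(fK q qH); congr map.
  apply: (cycle_edges_inj up uq) ee; last by rewrite lp lq.
    by move: sp; rewrite -sq => -[].
  by rewrite -ltnS; move: sp => /= ->.
apply/subset_leq_card/subsetP.
move=> C CL.
suff [CH xyC] : C \in hamilton_cycles (@basis_adj _ M) /\ [set x; y] \in C.
  by rewrite in_set CH xyC.
move: CL => /mapP[p pH ->]; have [up mp pp lp sp] := props p pH; split.
  have sc : size (x :: f p) = #|{: basis M}|.
    by rewrite -(card_uniqP up) (eq_card mp).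
  apply/imsetP; exists (tcast sc (in_tuple (x :: f p))); last first.
    by rewrite val_tcast.
  rewrite inE val_tcast; apply/and4P; split=> //.
  - by rewrite sp.
  - by apply/forallP => z; rewrite mp.
  - by rewrite /= rcons_path pp lp /=; rewrite /basis_adj setUC.
have := mem_cycle_edges up (leqnn (size (f p))).
by rewrite -last_nth lp nth_default // setUC.
Qed.

(** An edge has to exist because [nat_min] is 0 on the empty set. *)
Lemma HC_star_bound (m : nat) : 2 < #|bases M| ->
  (exists x y : basis M, basis_adj x y) ->
  (forall x y : basis M, basis_adj x y ->
    m <= size (hpaths (bases M) (val x) (val y))) -> m <= HC_star M.
Proof.
move=> c3 [x [y xy]] h; rewrite /HC_star /nat_min; case: pselect => [exS|[]].
  case: ex_minnP => _ /asboolP[eps /imset2P[u v _ + ->] ->] _.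
  by rewrite inE => /andP[_ uv]; apply: leq_trans (h _ _ uv) (hpaths_le_HC uv c3).
exists (HC [set x; y]); apply/asboolP; exists [set x; y] => //.
by apply/imset2P; exists x y; rewrite // inE.
Qed.

End BasisGraphBound.

(** * Cycle matroids *)

Lemma path_boundS r k : path_bound r.+1 k.+1 =
  r.+1 * k.+2 * (path_bound r k.+1 * path_bound r.+1 k).
Proof. by []. Qed.

Lemma path_bound_gt0 r k : 0 < path_bound r k.
Proof.
elim: r k => [|r IHr] k; first exact: fact_gt0.
elim: k => [|k IHk]; first by rewrite /= expn_gt0.
by rewrite path_boundS muln_gt0 /= muln_gt0 IHr.
Qed.

(** Thanks to this monotonicity a lower bound on the size of spanning trees is enough later. *)
Lemma path_bound_le r s k : r <= s -> path_bound r k <= path_bound s k.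
Proof.
move/subnKC <-; elim: (s - r) => [|m IH]; first by rewrite addn0.
rewrite addnS; apply: leq_trans IH _; move: (r + m) => t {r s m}.
case: k => [|k]; first by case: t => [|t] //=; rewrite leq_pexp2l.
rewrite path_boundS mulnCA; apply: leq_pmulr.
by rewrite !muln_gt0 path_bound_gt0.
Qed.

Section FramedSize.
Variables (E : finType) (BB : {set {set E}}) (I : {set E}) (r k : nat).
Hypotheses (frB : framed BB I r.+1 k.+3) (B0 : BB != set0).

Lemma framed_basis : exists (S : {set E}) (c : E),
  [/\ c \notin S, c |: S \in BB & c \notin I].
Proof.
have /set0Pn[B BB'] := B0; case: frB => _ fr _; have [IB cB] := fr B BB'.
have : B :\: I != set0.
  apply: contra_eq_neq cB; move/eqP; rewrite setD_eq0 => /subset_leq_card.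
  by rewrite neq_ltn addnS ltnS => cBI; rewrite (leq_trans cBI) // leq_addr.
case/set0Pn => c; rewrite inE => /andP[cI cB'].
by exists (B :\ c), c; rewrite setD1K // !inE eqxx.
Qed.

Lemma extensions_notin (S : {set E}) c x : c \notin S -> c |: S \in BB ->
  x \in extensions BB S -> x \notin S.
Proof.
case: frB => ex _ _ cS cSB; rewrite inE => xSB; apply/negP => xS.
by have := exchange_card ex cSB xSB; rewrite !cardsU1 cS xS add0n => /esym/n_Sn.
Qed.

Lemma framed_card : 2 < #|BB|.
Proof.
have [S [c [cS cSB cI]]] := framed_basis; have [_ _ co] := frB.
apply: leq_trans (_ : k.+3 <= _) => //; apply: leq_trans (co S c cS cSB cI) _.
rewrite -(card_in_imset (f := fun x => x |: S)); last first.
  by move=> u v /(extensions_notin cS cSB) uS _; apply: setU1_inj.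
by apply/subset_leq_card/subsetP => _ /imsetP[u + ->]; rewrite inE.
Qed.

Lemma framed_adj : exists X Y, [/\ X \in BB, Y \in BB & set_adj X Y].
Proof.
have [S [c [cS cSB cI]]] := framed_basis; have [_ _ co] := frB.
have /card_gt0P[x] : 0 < #|extensions BB S :\ c|.
  by apply: card_setD1_geq; apply: leq_trans (co S c cS cSB cI).
rewrite in_setD1 => /andP[xc xS]; exists (c |: S), (x |: S); split=> //.
  by move: xS; rewrite inE.
by apply: set_adj_swap; rewrite ?(extensions_notin cS cSB xS) // eq_sym.
Qed.

End FramedSize.

Section Graph.
Variable G : mgraph.
Implicit Types (F T S : {set edge G}) (e : edge G).

(** A minimal connected subset has no cycle, since an edge of a cycle could be deleted. *)
Lemma subtree F : connected_by F -> exists2 T, T \in tree_sets G & T \subset F.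
Proof.
move=> Fc; have [T /minsetP[Tc Tmin] TF] := minset_exists Fc.
exists T => //; apply/tree_setsP; split=> // -[|[w e] c] //.
apply/negP => cyc; have ec : e \in unzip2 ((w, e) :: c) by rewrite mem_head.
have eT : e \in T by case/and5P: cyc => _ _ _ /allP/(_ _ ec).
have [u [v euv]] := endsE e.
have cuv := cycle_in_connect cyc ec euv.
have [V0 Tcon] := connected_byP _ Tc.
suff /Tmin/(_ (subD1set _ _))/setP/(_ e) : connected_by (T :\ e).
  by rewrite !inE eqxx eT.
apply/connected_byP; split=> // x y.
apply: connect_sub (Tcon x y) => {}x {}y /existsP[f /andP[fT /eqP fxy]].
have [fe|fe] := eqVneq f e; last first.
  by apply/connect1/(@adj_in_edge _ _ f); rewrite // !inE fe.
have : x \in ends e by rewrite -fe fxy set21.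
have : y \in ends e by rewrite -fe fxy set22.
by rewrite euv !inE => /orP[]/eqP-> /orP[]/eqP->; rewrite // connect_adj_in_sym.
Qed.

(** While [S] is not everything, connectedness provides an edge of [F] leaving [S]; it is new
    because the edges of [T] lie inside [S]. *)
Lemma grow F m : connected_by F -> m < #|vertex G| ->
  exists (S : {set vertex G}) (T : {set edge G}),
    [/\ #|S| = m.+1, #|T| = m, T \subset F & forall e, e \in T -> ends e \subset S].
Proof.
case/connected_byP => V0 Fc; elim: m => [|m IH] ltm.
  have /card_gt0P[v _] := V0; exists [set v], set0.
  by rewrite cards1 cards0 sub0set; split=> // e; rewrite inE.
have [S [T [cS cT TF TS]]] := IH (ltnW ltm).
have /set0Pn[u uS] : S != set0 by rewrite -card_gt0 cS.
have /set0Pn[z] : ~: S != set0 by rewrite -card_gt0 cardsCs setCK cS subn_gt0.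
rewrite inE => zS.
have [x [y [/existsP[e /andP[eF /eqP exy]] xS yS]]] :=
  crossing (S := fun v => v \in S) (Fc u z) uS zS.
have eT : e \notin T.
  by apply: contra yS => /TS/subsetP; apply; rewrite exy set22.
exists (y |: S), (e |: T); split.
- by rewrite cardsU1 yS cS.
- by rewrite cardsU1 eT cT.
- by rewrite subUset sub1set eF.
move=> f /setU1P[->|/TS fS]; last exact: subset_trans fS (subsetUr _ _).
by rewrite exy subUset !sub1set !inE eqxx xS orbT.
Qed.

Lemma order_leq_connected F : connected_by F -> order_of G <= #|F|.+1.
Proof.
move=> Fc; case/connected_byP: (Fc) => V0 _.
have := @grow F (order_of G).-1 Fc; rewrite /order_of prednK // leqnn.
case=> // S [T [_ cT /subset_leq_card TF _]].
by rewrite -(prednK V0) ltnS -cT.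
Qed.

(** If [S] had fewer than [k] extensions, deleting them would leave a spanning tree [T]; exchanging
    [c] for an edge of [T] would produce an extension of [S] inside [T]. *)
Lemma tree_sets_framed k T0 : k_edge_connected G k -> T0 \in tree_sets G ->
  framed (tree_sets G) set0 #|T0| k.
Proof.
move=> [_ Gk] T0t; have ex : exchange (tree_sets G) := @tree_sets_exchange G.
split=> //.
  by move=> T Tt; rewrite sub0set cards0 add0n (exchange_card ex Tt T0t).
move=> S c cS cSt _; rewrite leqNgt; apply/negP => /Gk/subtree[T Tt /subsetP TF].
have cT : c \in (c |: S) :\: T.
  rewrite in_setD setU11 andbT; apply/negP => /TF.
  by rewrite in_setC mem_extensions cSt.
have [b bT] := ex _ _ _ cSt Tt cT; rewrite setU1K // => bS.
by move: bT; rewrite in_setD => /andP[_ /TF]; rewrite in_setC mem_extensions bS.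
Qed.

Lemma HC_star_cycle_matroid (Gc : connected G) n k : order_of G = n.+2 ->
  k_edge_connected G k.+3 -> path_bound n k.+1 <= HC_star (cycle_matroid Gc).
Proof.
move=> Gn Gk; have /set0Pn[T0 T0t] := tree_sets_neq0 Gc.
have nT : n < #|T0|.
  have /tree_setsP[/order_leq_connected + _] := T0t.
  by rewrite Gn ltnS.
have := tree_sets_framed Gk T0t; rewrite -(prednK (leq_ltn_trans (leq0n _) nT)).
move=> fr; have t0 := tree_sets_neq0 Gc.
apply: HC_star_bound.
- exact: framed_card fr t0.
- have [X [Y [Xt Yt XY]]] := framed_adj fr t0.
  by exists (exist _ X Xt), (exist _ Y Yt).
move=> x y xy; apply: leq_trans (_ : path_bound #|T0|.-1 k.+1 <= _).
  by apply: path_bound_le; rewrite -ltnS prednK // (leq_ltn_trans _ nT).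
exact: (hpaths_framed fr (valP x) (valP y) xy).
Qed.

End Graph.

(** * Existence of [k]-edge-connected graphs *)

Section MultiPath.
Variables n k : nat.

(** A path in which every edge is taken [k] times. It shows that [hc] is a minimum over a nonempty
    set and not the default 0 of [nat_min]. *)
Definition multipath_ends (e : 'I_n * 'I_k) : {set 'I_n.+1} :=
  [set widen_ord (leqnSn n) e.1; lift ord0 e.1].

Lemma card_multipath_ends e : #|multipath_ends e| = 2.
Proof. by rewrite cards2 -val_eqE /= /bump /= neq_ltn ltnSn. Qed.

Definition multipath := MGraph card_multipath_ends.

Lemma multipath_connected : 0 < n -> k_edge_connected multipath k.
Proof.
move=> n0; split; first by rewrite /order_of /= card_ord ltnS.
move=> F ltF; apply/connected_byP; split; first by rewrite /= card_ord.
have step (i : 'I_n) : connect (@adj_in multipath (~: F))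
    (widen_ord (leqnSn n) i) (lift ord0 i).
  (* Fewer than [k] deleted edges spare one of the [k] parallel copies. *)
  have [t tF] : exists t : 'I_k, (i, t) \notin F.
    apply/existsP; rewrite -negb_forall; apply: contraTN ltF => /forallP iF.
    rewrite -leqNgt -[X in X <= _](card_ord k).
    rewrite -(card_imset predT (f := fun t => (i, t))); last by move=> ? ? [].
    by apply/subset_leq_card/subsetP => _ /imsetP[t _ ->].
  by apply/connect1/(@adj_in_edge multipath _ (i, t)); rewrite ?inE.
have from0 (m : nat) (lt_m : m < n.+1) :
    connect (@adj_in multipath (~: F)) ord0 (Ordinal lt_m).
  elim: m lt_m => [|m IH] lt_m.
    by rewrite (_ : Ordinal lt_m = ord0) //; apply: val_inj.
  have -> : Ordinal lt_m = lift ord0 (Ordinal (ltnSE lt_m)) by exact: val_inj.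
  apply: connect_trans (step _).
  rewrite (_ : widen_ord _ _ = Ordinal (ltnW lt_m)) ?IH //; exact: val_inj.
move=> u v; apply: (@connect_trans _ _ ord0); last by case: v.
by rewrite (@connect_adj_in_sym multipath); case: u.
Qed.

End MultiPath.

Lemma k_edge_connected_connected (G : mgraph) k : 0 < k ->
  k_edge_connected G k -> connected G.
Proof.
by move=> k0 [_ /(_ set0)]; rewrite cards0 setC0; apply.
Qed.

Lemma hc_path_bound n k : path_bound n k.+1 <= hc n.+2 k.+3.
Proof.
rewrite /hc /nat_min; case: pselect => [exS|[]].
  case: ex_minnP => _ /asboolP[G [Gc [Gn Gk ->]]] _.
  exact: HC_star_cycle_matroid.
have Gk := @multipath_connected n.+1 k.+3 isT.
pose Gc := k_edge_connected_connected (ltn0Sn _) Gk.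
exists (HC_star (cycle_matroid Gc)); apply/asboolP; exists (multipath n.+1 k.+3), Gc.
by split=> //; rewrite /order_of /= card_ord.
Qed.

(** * The closed form *)

Lemma superfactorialS x : superfactorial x.+1 = superfactorial x * x.+1`!.
Proof. by rewrite /superfactorial big_ord_recr. Qed.

(** In rank 2 each step of the recursion contributes the next factorial. *)
Lemma path_bound1 k : path_bound 1 k = superfactorial k.+1.
Proof.
elim: k => [|k IH]; first by rewrite /superfactorial !big_ord_recr big_ord0.
by rewrite path_boundS IH [RHS]superfactorialS [k.+2`!]factS [path_bound 0 _]/=; ring.
Qed.

Lemma path_bound_cogirth3 r : path_bound r 1 = 2 ^ 'C(r.+1, 2) * r`!.
Proof.
elim: r => [|r IH] //; rewrite path_boundS IH [path_bound _ 0]/= (binS r.+1) bin1 expnD.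
by rewrite expnS factS; ring.
Qed.

Arguments path_bound : simpl never.

(** Pascal's rule in every exponent. The factor at [t = b.+1] has exponent 1 on the left and in the
    first product on the right, and is absent from the second. *)
Lemma prod_expn_binS (f : nat -> nat) a b :
  \prod_(t < b.+2) f t ^ 'C(a + b + 2 - t, a.+1) =
  \prod_(t < b.+2) f t ^ 'C(a + b.+1 - t, a) *
  \prod_(t < b.+1) f t ^ 'C(a.+1 + b - t, a.+1).
Proof.
rewrite big_ord_recr [X in _ = X * _]big_ord_recr /= mulnAC -big_split /=.
congr (_ * _).
  apply: eq_bigr => t _; rewrite -expnD; congr (_ ^ _).
  have tb := ltn_ord t.
  have -> : a + b + 2 - t = (a + b.+1 - t).+1 by lia.
  by rewrite binS addnC addSnnS.
have -> : a + b + 2 - b.+1 = a.+1 by lia.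
have -> : a + b.+1 - b.+1 = a by lia.
by rewrite !binn.
Qed.

(* The numerator of the bound for [n = p.+4] and [k = q.+4]. *)
Definition numerator p q :=
  2 ^ 'C(p + q + 4, p.+1) * 3 ^ 'C(p + q + 1, q.+1)
  * \prod_(t < q.+1) (t.+4 * superfactorial t.+3) ^ 'C(p + q - t, p)
  * \prod_(u < p.+1) (u.+3)`! ^ 'C(p + q - u, q).

(** Pascal's rule in all exponents; for the product of factorials the roles of [p] and [q] are
    exchanged. *)
Lemma numeratorS p q :
  numerator p.+1 q.+1 = numerator p q.+1 * numerator p.+1 q.
Proof.
rewrite /numerator.
have -> : p.+1 + q.+1 + 4 = (p + q + 5).+1 by lia.
have -> : p.+1 + q.+1 + 1 = (p + q + 2).+1 by lia.
have -> : p + q.+1 + 4 = p + q + 5 by lia.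
have -> : p.+1 + q + 4 = p + q + 5 by lia.
have -> : p + q.+1 + 1 = p + q + 2 by lia.
have -> : p.+1 + q + 1 = p + q + 2 by lia.
rewrite (binS _ p.+1) (binS _ q.+1) !expnD.
have -> : p.+1 + q.+1 = p + q + 2 by lia.
rewrite (prod_expn_binS (fun t => t.+4 * superfactorial t.+3)).
have -> : p + q + 2 = q + p + 2 by lia.
rewrite (prod_expn_binS (fun t => t.+3`!)) [q + p.+1]addnC [q.+1 + p]addnC.
ring.
Qed.

(** The factor [p.+3 * q.+4], that is [(n - 1) * k], absorbs the coefficients of the recursion and
    turns it into [numeratorS]; the boundary cases rest on [path_bound1] and
    [path_bound_cogirth3]. *)
Lemma numeratorE p q :
  numerator p q = p.+3 * q.+4 * path_bound p.+2 q.+2.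
Proof.
elim: p q => [|p IHp].
  move=> q; have -> : numerator 0 q =
      2 ^ q.+4 * 3 * \prod_(t < q.+1) (t.+4 * superfactorial t.+3) * 6.
    rewrite /numerator add0n bin1 addn4 addn1 !binn !expn1 big_ord1.
    rewrite subn0 binn expn1.
    by congr (_ * _ * _); apply: eq_bigr => t _; rewrite bin0 expn1.
  elim: q => [|q IHq].
    have sf3 : superfactorial 3 = 12.
      by rewrite /superfactorial !big_ord_recr big_ord0.
    by rewrite big_ord1 path_boundS path_bound1 path_bound_cogirth3 sf3.
  rewrite big_ord_recr /= path_boundS path_bound1.
  transitivity (2 * (q.+1.+4 * superfactorial q.+4) *
    (2 ^ q.+4 * 3 * \prod_(t < q.+1) (t.+4 * superfactorial t.+3) * 6)).
    by rewrite expnS; ring.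
  by rewrite IHq; ring.
elim=> [|q IHq].
  have -> : numerator p.+1 0 = 2 ^ 'C(p.+4, 2) * 3 * p.+4`! * numerator p 0.
    rewrite /numerator.
    have -> : p.+1 + 0 + 4 = p.+4.+1 by lia.
    have -> : p + 0 + 4 = p.+4 by lia.
    rewrite [p.+1 + 0 + 1]addn1 [p + 0 + 1]addn1 !addn0 !bin1 expnS.
    rewrite [X in _ * X]big_ord_recr /= bin0 expn1 !big_ord1 !subn0 !binn.
    have binE : 'C(p.+4, p.+2) = 'C(p.+4, 2).
      by rewrite -[RHS]bin_sub //; congr 'C(_, _); lia.
    rewrite binS expnD binE.
    under eq_bigr do rewrite bin0.
    under [in RHS]eq_bigr do rewrite bin0.
    ring.
  rewrite IHp [path_bound p.+3 2]path_boundS path_bound_cogirth3 (factS p.+3); ring.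
rewrite numeratorS IHp IHq [path_bound p.+3 q.+3]path_boundS; ring.
Qed.

Import Order.TTheory GRing.Theory Num.Theory.
Local Open Scope ring_scope.

Theorem theorem2p19 (n k : nat) (hn : (4 <= n)%N) (hk : (4 <= k)%N) :
  2 ^+ 'C(n + k - 4, n - 3) * 3 ^+ 'C(n + k - 7, k - 3) / ((n - 1) * k)%N%:R
    * (\prod_(4 <= r < k.+1)
         (r * superfactorial (r - 1))%N%:R ^+ 'C(n + k - 4 - r, n - 4))
    * (\prod_(4 <= s < n.+1) ((s - 1)`!)%:R ^+ 'C(n + k - 4 - s, k - 4))
  <= (hc n k)%:R :> rat.
Proof.
have [p nE] : exists p, n = p.+4 by exists (n - 4)%N; lia.
have [q kE] : exists q, k = q.+4 by exists (k - 4)%N; lia.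
subst n k.
have e1 : (p.+4 + q.+4 - 4 = p + q + 4)%N by lia.
have e2 : (p.+4 + q.+4 - 7 = p + q + 1)%N by lia.
have e3 : (p.+4 - 3 = p.+1)%N by lia.
have e4 : (q.+4 - 3 = q.+1)%N by lia.
have e5 : (p.+4 - 4 = p)%N by lia.
have e6 : (q.+4 - 4 = q)%N by lia.
have e7 : (p.+4 - 1 = p.+3)%N by lia.
have e8 m t : (m + 4 - (t + 4) = m - t)%N by lia.
have e9 t : (t + 4 - 1 = t.+3)%N by lia.
have e10 m : (m.+4.+1 - 4 = m.+1)%N by lia.
(* Both products start at 4; shifting the index by 4 brings them to the form in [numerator]. *)
have prodE (f : nat -> nat -> nat) m :
    \prod_(4 <= t < m.+4.+1) ((f t (p + q + 4 - t)%N)%:R : rat)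
    = (\prod_(t < m.+1) f (t + 4) (p + q - t))%N%:R.
  rewrite -{1}[4%N]add0n big_addn e10 big_mkord natr_prod.
  by apply: eq_bigr => t _; rewrite e8.
rewrite e1 e2 e3 e4 e5 e6 e7.
under eq_bigr do rewrite -natrX.
rewrite (prodE (fun t s => (t * superfactorial (t - 1)) ^ 'C(s, p))%N q).
under eq_bigr do rewrite -natrX.
rewrite (prodE (fun t s => (t - 1)`! ^ 'C(s, q))%N p).
have := numeratorE p q; rewrite /numerator => numE.
apply: (@le_trans _ _ ((path_bound p.+2 q.+2)%:R)); last first.
  by rewrite ler_nat hc_path_bound.
have d0 : (p.+3 * q.+4)%N%:R != 0 :> rat by rewrite pnatr_eq0.
(* The left-hand side is exactly [path_bound p.+2 q.+2]; clearing the denominator reduces this to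
   [numeratorE]. *)
rewrite le_eqVlt; apply/orP; left; apply/eqP; apply: (mulIf d0).
rewrite -[RHS]natrM [in RHS]mulnC -numE !natrM !natrX.
have -> : (\prod_(t < q.+1)
    ((t + 4) * superfactorial (t + 4 - 1)) ^ 'C(p + q - t, p))%N =
    (\prod_(t < q.+1) (t.+4 * superfactorial t.+3) ^ 'C(p + q - t, p))%N.
  by apply: eq_bigr => t _; rewrite e9 addn4.
have -> : (\prod_(t < p.+1) (t + 4 - 1)`! ^ 'C(p + q - t, q))%N =
    (\prod_(t < p.+1) (t.+3)`! ^ 'C(p + q - t, q))%N.
  by apply: eq_bigr => t _; rewrite e9.
have cancel (x d y z : rat) : d != 0 -> x / d * y * z * d = x * y * z.
  by move=> d_neq0; field.
by rewrite -natrM cancel.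
Qed.
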